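(* Suppose $n-k\ge 2$ (with $k\ge1$). Then (1) $P_{n,k}$ is an upper order ideal of $Q_{n,2}$ with $\binom{n}{k}$ minimal elements, namely the elements $(L,\{\})$ with $|L|=k$; (2) $P_{n,k}=\{\mathcal N\in Q_{n,2}: e(\mathcal N)\ge 0\}$; (3) $P_{n,k}$ is graded of height $2k$, with rank function $d(\mathcal N)$ and corank function $c(\mathcal N)$.
   Context: Matroids on $[n]$ are given by their set of bases. For $a\in[n]$, $\le_a$ is the cyclic order $a<_a a+1<_a\cdots<_a n<_a 1<_a\cdots<_a a-1$; the Grassmann necklace $(I_1,\dots,I_n)$ of a matroid has $I_a$ the lexicographically minimal basis w.r.t. $\le_a$. A positroid is the matroid of a point of a totally nonnegative Grassmannian; $Q_{n,k}$ is the poset of rank $k$ positroids on $[n]$ under inclusion; $\mathrm{env}(\mathcal M)$ is the smallest positroid containing $\mathcal M$. For a rank $k$ matroid $\mathcal M$, $\mathcal M^*=\{[n]\setminus J:J\in\mathcal M\}$ and $\mathcal M^{\downarrow2}=\{I\in\binom{[n]}{2}: I\subset J \text{ for some } J\in\mathcal M^*\}$. $P_{n,k}$ is the subposet of $Q_{n,2}$ consisting of all $\mathrm{env}(\mathcal M^{\downarrow 2})$, $\mathcal M\in Q_{n,k}$. Every rank 2 positroid on $[n]$ is described as $\mathcal N=(L,\{[a_1,b_1],\dots,[a_r,b_r]\})$: $L\subset[n]$ is the set of loops, and $[a_i,b_i]$ are pairwise disjoint cyclic intervals of $[n]$ each of rank $1$ (all non-loops in $[a_i,b_i]$ are parallel),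 where $r$ is taken minimal and each interval as small as possible (so each interval contains at least two non-loops and its endpoints are not loops); $\mathcal N=(L,\{\})$ means $r=0$. Set $S=\bigcup_i[a_i,b_i]$ and $d(\mathcal N)=2k+r-|S\setminus L|-2|L|$, $c(\mathcal N)=2k-d(\mathcal N)$, $e(\mathcal N)=r+k-|S\cup L|$. *)

(* Defs.v *)
From HB Require Import structures.
From mathcomp Require Import all_boot all_order all_algebra.
From mathcomp Require Import boolp reals.

Set Implicit Arguments.
Unset Strict Implicit.
Unset Printing Implicit Defensive.

Import Order.TTheory GRing.Theory Num.Theory.
Local Open Scope ring_scope.

(* The ground set [n] is 'I_n (so 0-based), and a matroid on [n] is its set of
   bases, of type {set {set 'I_n}}. *)

Section Positroids.

Definition increasing (k n : nat) (f : {ffun 'I_k -> 'I_n}) : bool :=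
  [forall i : 'I_k, forall j : 'I_k, (i < j)%N ==> (f i < f j)%N].

(* The k-subsets of [n] are the images of the increasing maps f : [k] -> [n],
   and \det (colsub f A) is the corresponding maximal minor of A. *)
Definition tnn (R : realType) (k n : nat) (A : 'M[R]_(k, n)) : Prop :=
  row_free A /\
  forall f : {ffun 'I_k -> 'I_n}, increasing f -> 0 <= \det (colsub f A).

Definition matroid_of (R : realType) (k n : nat) (A : 'M[R]_(k, n)) :
    {set {set 'I_n}} :=
  [set f @: [set: 'I_k] |
     f : {ffun 'I_k -> 'I_n} & increasing f && (\det (colsub f A) != 0)].

(* The carrier of Q_{n,k}; its order is inclusion \subset. *)
Definition Qnk (R : realType) (n k : nat) (M : {set {set 'I_n}}) : Prop :=
  exists A : 'M[R]_(k, n), tnn A /\ M = matroid_of A.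

Definition is_positroid (R : realType) (n : nat) (M : {set {set 'I_n}}) : Prop :=
  exists k : nat, Qnk R k M.

(* E = env(M) *)
Definition is_env (R : realType) (n : nat) (M E : {set {set 'I_n}}) : Prop :=
  [/\ is_positroid R E, M \subset E &
      forall E', is_positroid R E' -> M \subset E' -> E \subset E'].

Definition dual (n : nat) (M : {set {set 'I_n}}) : {set {set 'I_n}} :=
  [set ~: J | J : {set 'I_n} in M].

Definition down2 (n : nat) (M : {set {set 'I_n}}) : {set {set 'I_n}} :=
  [set I : {set 'I_n} | (#|I| == 2) && [exists J in dual M, I \subset J]].

(* The carrier of P_{n,k}; its order is inclusion \subset. *)
Definition Pnk (R : realType) (n k : nat) (N : {set {set 'I_n}}) : Prop :=
  Qnk R 2 N /\ exists M : {set {set 'I_n}}, Qnk R k M /\ is_env R (down2 M) N.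

End Positroids.

Section RankTwo.

Variable n : nat.
Implicit Types (N F : {set {set 'I_n}}) (L I J B : {set 'I_n}).

(* cycpos a x is the position of x, counted from 0, in the cyclic order
   a <_a a+1 <_a ... <_a a-1 *)
Definition cycpos (a x : 'I_n) : nat := ((x + n - a) %% n)%N.

Definition cyc_itv (a b : 'I_n) : {set 'I_n} :=
  [set x | (cycpos a x <= cycpos a b)%N].

Definition is_cyc_itv I : bool := [exists a, exists b, I == cyc_itv a b].

Definition loops N : {set 'I_n} := [set x | [forall B in N, x \notin B]].

(* The rank 2 matroid (L, F): its bases are the pairs of non-loops which are
   not contained in a common interval of F. *)
Definition rank2_matroid L F : {set {set 'I_n}} :=
  [set B : {set 'I_n} |
     [&& #|B| == 2, [disjoint B & L] & [forall I in F, ~~ (B \subset I)]]].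

Definition describes F N : bool :=
  [&& trivIset F, [forall I in F, is_cyc_itv I] & N == rank2_matroid (loops N) F].

(* r = #|F| is minimal, and no interval of F can be shrunk. *)
Definition reduced F N : bool :=
  [&& describes F N,
      [forall F' : {set {set 'I_n}}, describes F' N ==> (#|F| <= #|F'|)%N] &
      [forall I : {set 'I_n} in F, forall J : {set 'I_n},
         is_cyc_itv J && (J \proper I) ==> ~~ describes (J |: (F :\ I)) N]].

(* The family {[a_1,b_1], ..., [a_r,b_r]}.  When N is a rank 2 positroid there
   is exactly one F with reduced F N: its intervals correspond to the parallel
   classes with at least two elements, and have non-loops as endpoints.
   The default set0 is irrelevant. *)
Definition intervals N : {set {set 'I_n}} := odflt set0 [pick F | reduced F N].

Definition itv_union N : {set 'I_n} := cover (intervals N).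

Definition d_rank (k : nat) N : int :=
  (2 * k)%:Z + #|intervals N|%:Z - #|itv_union N :\: loops N|%:Z - (2 * #|loops N|)%:Z.

Definition c_corank (k : nat) N : int := (2 * k)%:Z - d_rank k N.

Definition e_stat (k : nat) N : int :=
  #|intervals N|%:Z + k%:Z - #|itv_union N :|: loops N|%:Z.

End RankTwo.

(* Posets of sets ordered by inclusion, given by their carrier X. *)
Section Posets.

Variable T : finType.
Implicit Types (X Y : {set T} -> Prop) (C : {set {set T}}).

Definition upper_order_ideal X Y : Prop :=
  (forall x, X x -> Y x) /\
  (forall x y : {set T}, X x -> Y y -> x \subset y -> X y).

Definition minimal X (x : {set T}) : Prop :=
  X x /\ forall y : {set T}, X y -> y \subset x -> y = x.

Definition maximal X (x : {set T}) : Prop :=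
  X x /\ forall y : {set T}, X y -> x \subset y -> y = x.

(* y covers x *)
Definition covered_by X (x y : {set T}) : Prop :=
  [/\ X x, X y, x \proper y &
      forall z : {set T}, X z -> ~ (x \proper z /\ z \proper y)].

Definition is_chain X C : Prop :=
  (forall x, x \in C -> X x) /\
  (forall x y, x \in C -> y \in C -> x \subset y \/ y \subset x).

Definition maximal_chain X C : Prop :=
  is_chain X C /\ forall C', is_chain X C' -> C \subset C' -> C' = C.

(* All maximal chains have length h, i.e., h + 1 elements. *)
Definition graded_of_height X (h : nat) : Prop :=
  forall C, maximal_chain X C -> #|C| = h.+1.

Definition rank_function X (rho : {set T} -> int) : Prop :=
  (forall x, minimal X x -> rho x = 0) /\
  (forall x y, covered_by X x y -> rho y = rho x + 1).

Definition corank_function X (rho : {set T} -> int) : Prop :=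
  (forall x, maximal X x -> rho x = 0) /\
  (forall x y, covered_by X x y -> rho x = rho y + 1).

End Posets.

(* Main.v *)
Require Import Defs.
From HB Require Import structures.
From mathcomp Require Import all_boot all_order all_algebra all_fingroup.
From mathcomp Require Import boolp reals.
From mathcomp Require Import zify ring lra.

(* A rank 2 positroid is the same thing as a set of loops together with a
   noncrossing partition of the nonloops, cyclically ordered, into at least two
   parallel classes: necessity is the three-term Pluecker relation, sufficiency
   an explicit matrix. If c is the number of classes and w the number of
   nonloops, then e = c - (n - k) and d = c + w - 2(n - k). A basis J of M in
   Q_{n,k} gives n - k pairwise non-parallel elements ~: J of any N containing
   M^{down 2}, so e(N) >= 0. Conversely, if c >= n - k, start from the single
   basis whose complement X consists of representatives of n - k classes, and
   add the other nonloops of N one at a time by the column operation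
   "col_j += +-col_x" (dually, "v_x += v_j") with j a cyclic neighbour of x
   among the elements already present: one operation if a neighbour is parallel
   to x, both neighbours otherwise. As x and j are neighbours, one choice of
   sign adds a nonnegative term to every maximal minor, so the result is totally
   nonnegative; its bases are then easy to read off, and its M^{down 2} is N.
   For the grading, c + w is strictly monotone for inclusion, and between
   N < N' there is always an element with c + w one less than for N', obtained
   by turning an element of a class of size at least 2 into a loop or by merging
   two neighbouring classes. *)

Set Implicit Arguments.
Unset Strict Implicit.
Unset Printing Implicit Defensive.

Import Order.TTheory GRing.Theory Num.Theory.
Local Open Scope ring_scope.

(** * Maximal minors and column operations *)

Lemma increasingP (k n : nat) (f : {ffun 'I_k -> 'I_n}) :
  reflect {homo f : i j / (i < j)%N} (increasing f).
Proof.
apply: (iffP forallP) => [H i j ij|H i]; last first.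
  by apply/forallP=> j; apply/implyP; apply: H.
by move/forallP: (H i) => /(_ j) /implyP /(_ ij).
Qed.

Lemma homo_ltn_mono (k n : nat) (f : 'I_k -> 'I_n) :
  {homo f : i j / (i < j)%N} -> {mono f : i j / (i < j)%N}.
Proof.
move=> H i j; case: (ltngtP i j) => [ij|ji|/val_inj ->]; last by rewrite ltnn.
  exact: H.
by apply/negbTE; rewrite -leqNgt ltnW // H.
Qed.

Lemma homo_ltn_inj (k n : nat) (f : 'I_k -> 'I_n) :
  {homo f : i j / (i < j)%N} -> injective f.
Proof.
move=> H i j ij; case: (ltngtP i j) => [/H|/H|/val_inj //]; by rewrite ij ltnn.
Qed.

Lemma card_ltn_ord (k : nat) (i : 'I_k) : #|[set j : 'I_k | (j < i)%N]| = i.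
Proof.
rewrite -sum1dep_card (big_ord_narrow (ltnW (ltn_ord i))) /=.
by rewrite sum1_card card_ord.
Qed.

Lemma rank_in_image (k n : nat) (f : 'I_k -> 'I_n) (i : 'I_k) :
  {homo f : i j / (i < j)%N} ->
  #|[set x in f @: [set: 'I_k] | (x < f i)%N]| = i.
Proof.
move=> H; rewrite -[RHS]card_ltn_ord -(card_imset _ (homo_ltn_inj H)).
apply: eq_card => x; rewrite !inE; apply/andP/imsetP => [[/imsetP[j _ ->]]|[j]].
  by rewrite homo_ltn_mono // => ji; exists j; rewrite ?inE.
by rewrite inE => ji ->; split; rewrite ?imset_f ?homo_ltn_mono.
Qed.

(** By [rank_in_image], [i] is the number of elements of the image below [f i], so the image
    determines an increasing map. *)
Lemma homo_ltn_eq (k n : nat) (f g : 'I_k -> 'I_n) :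
  {homo f : i j / (i < j)%N} -> {homo g : i j / (i < j)%N} ->
  f @: [set: 'I_k] = g @: [set: 'I_k] -> f =1 g.
Proof.
move=> Hf Hg E i; have : f i \in g @: [set: 'I_k] by rewrite -E imset_f ?inE.
case/imsetP=> j _ fg; suff ij : i = j by rewrite fg ij.
by apply: ord_inj; rewrite -(rank_in_image i Hf) -(rank_in_image j Hg) E fg.
Qed.

Lemma increasing_enum (k n : nat) (S : {set 'I_n}) : #|S| = k ->
  exists2 f : {ffun 'I_k -> 'I_n}, increasing f & f @: [set: 'I_k] = S.
Proof.
move=> <-; exists [ffun i => enum_val i]; last first.
  apply/setP=> x; apply/imsetP/idP => [[i _ ->]|xS].
    by rewrite ffunE enum_valP.
  by exists (enum_rank_in xS x); rewrite ?inE // ffunE enum_rankK_in.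
apply/increasingP=> i j ij; rewrite !ffunE.
have srt : sorted ltn (map val (enum S)).
  rewrite {1}/enum_mem -enumT.
  apply: (subseq_sorted ltn_trans) (iota_ltn_sorted 0 n).
  by rewrite -val_enum_ord map_subseq // filter_subseq.
have valE (m : 'I_#|S|) : enum_val m = nth 0%N (map val (enum S)) m :> nat.
  by rewrite (nth_map (enum_val m)) -?cardE // -enum_val_nth.
by rewrite !valE (sorted_ltn_nth ltn_trans) // inE size_map -cardE.
Qed.

Lemma minor_row_free (F : fieldType) (k n : nat) (A : 'M[F]_(k, n))
    (f : 'I_k -> 'I_n) :
  \det (colsub f A) != 0 -> row_free A.
Proof.
move=> d; have : colsub f A \in unitmx by rewrite unitmxE unitfE.
rewrite -row_free_unit /row_free => /eqP r; rewrite eqn_leq rank_leq_row -{1}r.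
have -> : colsub f A = A *m colsub f 1%:M by rewrite mulmx_colsub mulmx1.
exact: mxrankM_maxl.
Qed.

(** [fullrankfun] selects independent columns in an arbitrary order. The selection factors as
    [g \o h] with [g] increasing, and choosing columns [h] of [colsub g A] can give an invertible
    matrix only if [colsub g A] is invertible. *)
Lemma row_free_minor (F : fieldType) (k n : nat) (A : 'M[F]_(k, n)) :
  row_free A -> exists2 f : {ffun 'I_k -> 'I_n},
    increasing f & \det (colsub f A) != 0.
Proof.
rewrite /row_free -mxrank_tr => fA.
pose f := fullrankfun fA.
have [g ig Eg] : exists2 g : {ffun 'I_k -> 'I_n},
    increasing g & g @: [set: 'I_k] = f @: [set: 'I_k].
  by apply: increasing_enum; rewrite card_imset ?cardsT ?card_ord //;
     apply: fullrankfun_inj.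
exists g => //.
have fg i : exists j, f i == g j.
  have : f i \in g @: [set: 'I_k] by rewrite Eg imset_f ?inE.
  by case/imsetP=> j _ ->; exists j.
pose h i := xchoose (fg i).
have fE : f =1 g \o h by move=> i; apply/eqP/(xchooseP (fg i)).
have := fullrowsub_unit fA; rewrite -unitmx_tr unitmxE unitfE => d.
have {d} : \det (colsub h (colsub g A)) != 0.
  rewrite -colsub_comp; move: d; congr (_ != 0); congr (\det _).
  by apply/matrixP=> i j; rewrite !mxE -/f fE.
by move/minor_row_free; rewrite row_free_unit unitmxE unitfE.
Qed.

Lemma QnkP (R : realType) (n k : nat) (M : {set {set 'I_n}}) :
  Qnk R k M -> (M != set0) /\ forall S, S \in M -> #|S| = k.
Proof.
case=> A [[rA _] ->]; split.
  have [f If df] := row_free_minor rA.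
  apply/set0Pn; exists (f @: [set: 'I_k]); apply/imsetP.
  by exists f; rewrite // inE If.
move=> S /imsetP[f]; rewrite inE => /andP[/increasingP If _] ->.
by rewrite card_imset ?cardsT ?card_ord //; apply: homo_ltn_inj.
Qed.

Lemma Qnk_singleton (R : realType) (n k : nat) (J : {set 'I_n}) :
  #|J| = k -> Qnk R k [set J].
Proof.
move=> /increasing_enum[f If fJ].
(* The columns in [J] form an identity matrix and the others vanish. An increasing [g] other than
   [f] misses some [f i], so row [i] of its minor is zero. *)
pose A : 'M[R]_(k, n) := \matrix_(i, x) (f i == x)%:R.
have minorE (g : {ffun 'I_k -> 'I_n}) : increasing g ->
    \det (colsub g A) = (g == f)%:R.
  move=> Ig; case: eqVneq => [->|neq].
    rewrite (_ : colsub f A = 1%:M) ?det1 //; apply/matrixP=> i j.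
    by rewrite !mxE (inj_eq (homo_ltn_inj (increasingP _ If))).
  have [i fi] : exists i, f i \notin g @: [set: 'I_k].
    apply/existsP; move: neq; apply: contraR; rewrite negb_exists => /forallP H.
    apply/eqP/ffunP; apply: homo_ltn_eq; try exact/increasingP.
    apply/esym/eqP; rewrite eqEcard; apply/andP; split.
      by apply/subsetP=> _ /imsetP[j _ ->]; move: (H j); rewrite negbK.
    by rewrite !card_imset //; apply/homo_ltn_inj/increasingP.
  rewrite (expand_det_row _ i) big1 // => j _; rewrite !mxE.
  case: eqP => [E|]; last by rewrite mul0r.
  by rewrite E imset_f in fi.
exists A; split; first split.
- by apply: (@minor_row_free _ _ _ _ f); rewrite minorE // eqxx oner_neq0.
- by move=> g Ig; rewrite minorE // ler0n.
apply/setP=> S; rewrite inE; apply/eqP/imsetP => [->|[g]].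
  by exists f; rewrite // inE If minorE // eqxx oner_neq0.
rewrite inE => /andP[Ig]; rewrite minorE //.
by case: (eqVneq g f) => [-> _ -> //|_]; rewrite eqxx.
Qed.

Lemma homo_ltn_lift (k n : nat) (f : 'I_k.+1 -> 'I_n) (p : 'I_k.+1) :
  {homo f : i j / (i < j)%N} -> {homo f \o lift p : i j / (i < j)%N}.
Proof. by move=> H i j ij; apply: H; rewrite /= !ltnNge leq_bump2 -ltnNge. Qed.

Lemma imset_lift (k n : nat) (f : 'I_k.+1 -> 'I_n) (p : 'I_k.+1) :
  injective f ->
  (f \o lift p) @: [set: 'I_k] = (f @: [set: 'I_k.+1]) :\ f p.
Proof.
move=> If; apply/setP=> x; rewrite !inE; apply/imsetP/andP => [[r _ ->]|].
  by rewrite /= (inj_eq If) eq_sym neq_lift imset_f ?inE.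
case=> + /imsetP[r _ xr]; rewrite {}xr (inj_eq If).
by case: (unliftP p r) => [s ->|->]; [exists s | rewrite eqxx].
Qed.

(* Sorting the columns after j has been replaced by i moves one column past
   the elements of U lying between i and j. *)
Lemma det_replace_col (R : comNzRingType) (k n : nat) (A : 'M[R]_(k, n))
    (f g : 'I_k -> 'I_n) (i j : 'I_n) (U : {set 'I_n}) :
  {homo f : i j / (i < j)%N} -> {homo g : i j / (i < j)%N} ->
  i \notin U -> j \notin U ->
  f @: [set: 'I_k] = j |: U -> g @: [set: 'I_k] = i |: U ->
  \det (colsub (fun x => if f x == j then i else f x) A) =
  (-1) ^+ (odd #|[set x in U | (x < i)%N]| (+) odd #|[set x in U | (x < j)%N]|)
    * \det (colsub g A).
Proof.
move=> Hf Hg iU jU Ef Eg.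
have If := homo_ltn_inj Hf; have Ig := homo_ltn_inj Hg.
have [p _ fp] : exists2 p, p \in [set: 'I_k] & j = f p.
  by apply/imsetP; rewrite Ef setU11.
have [q _ gq] : exists2 q, q \in [set: 'I_k] & i = g q.
  by apply/imsetP; rewrite Eg setU11.
case: k A f g Hf Hg If Ig Ef Eg p q fp gq => [|k] A f g Hf Hg If Ig Ef Eg p q fp gq.
  by case: p fp.
have pE : p = #|[set x in U | (x < j)%N]| :> nat.
  rewrite -(rank_in_image p Hf) Ef -fp; apply: eq_card => x; rewrite !inE.
  by case: eqVneq => //= ->; rewrite ltnn andbF.
have qE : q = #|[set x in U | (x < i)%N]| :> nat.
  rewrite -(rank_in_image q Hg) Eg -gq; apply: eq_card => x; rewrite !inE.
  by case: eqVneq => //= ->; rewrite ltnn andbF.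
have fg : f \o lift p =1 g \o lift q.
  apply: homo_ltn_eq; try exact: homo_ltn_lift.
  by rewrite !imset_lift // -fp -gq Ef Eg !setU1K.
rewrite -qE -pE.
pose s := lift_perm p q 1%g.
have -> : colsub (fun x => if f x == j then i else f x) A = col_perm s (colsub g A).
  apply/matrixP=> r x; rewrite !mxE; congr (A r _).
  case: (unliftP p x) => [y ->|->]; last by rewrite -fp eqxx lift_perm_id.
  rewrite fp (inj_eq If) eq_sym (negbTE (neq_lift _ _)) lift_perm_lift perm1.
  exact: fg.
rewrite col_permE det_mulmx det_perm odd_permV odd_lift_perm odd_perm1 addbF.
by rewrite mulrC addbC.
Qed.

(** * Adding a multiple of one column to another *)

Definition add_col (R : nzRingType) (k n : nat) (A : 'M[R]_(k, n)) (i j : 'I_n) (c : R) :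
    'M[R]_(k, n) :=
  \matrix_(r, x) (A r x + (if x == j then c * A r i else 0)).

(** Multilinearity in column [j]; the extra term has a repeated column when [i] is selected too. *)
Lemma det_add_col (R : comNzRingType) (k n : nat) (A : 'M[R]_(k, n))
    (i j : 'I_n) (c : R) (f : 'I_k -> 'I_n) : injective f -> i != j ->
  \det (colsub f (add_col A i j c)) =
  \det (colsub f A) +
  if (j \in f @: [set: 'I_k]) && (i \notin f @: [set: 'I_k])
  then c * \det (colsub (fun x => if f x == j then i else f x) A) else 0.
Proof.
move=> If ij; case: (boolP (j \in _)) => /= [/imsetP[p _ jp]|jf]; last first.
  rewrite addr0; congr (\det _); apply/matrixP=> r x; rewrite !mxE.
  case: (eqVneq (f x) j) => [fx|_]; last by rewrite addr0.
  by rewrite -fx imset_f ?inE in jf.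
pose f' x := if f x == j then i else f x; rewrite -/f'.
have -> : \det (colsub f (add_col A i j c)) =
    \det (colsub f A) + c * \det (colsub f' A).
  rewrite -det_tr -[\det (colsub f A)]det_tr -[\det (colsub f' A)]det_tr -[X in X + _]mul1r.
  apply: (@determinant_multilinear _ _ _ _ _ p).
  - by apply/rowP=> r; rewrite !mxE /f' -jp eqxx mul1r.
  - apply/matrixP=> r x; rewrite !mxE jp (inj_eq If) eq_sym (negbTE (neq_lift _ _)).
    by rewrite addr0.
  - apply/matrixP=> r x; rewrite !mxE /f' jp (inj_eq If) eq_sym (negbTE (neq_lift _ _)).
    by rewrite addr0.
case: ifPn => //; rewrite negbK => /imsetP[q _ iq].
rewrite -[\det (colsub f' A)]det_tr.
rewrite (@determinant_alternate _ _ _ p q) ?mulr0 //.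
  by apply: contraNneq ij => pq; rewrite iq jp pq.
by move=> r; rewrite !mxE /f' -jp eqxx -iq (negbTE ij).
Qed.

(** The bases after [col_j += c * col_i] with [c] nonzero, provided that nothing cancels. For plabic
    graphs this is the addition of a bridge. *)
Definition bridge (n : nat) (M : {set {set 'I_n}}) (i j : 'I_n) : {set {set 'I_n}} :=
  M :|: [set j |: (S :\ i) | S in [set S in M | (i \in S) && (j \notin S)]].

Lemma bridgeP (n : nat) (M : {set {set 'I_n}}) (i j : 'I_n) (T : {set 'I_n}) :
  reflect (T \in M \/ exists S, [/\ S \in M, i \in S, j \notin S & T = j |: (S :\ i)])
          (T \in bridge M i j).
Proof.
rewrite !inE; apply: (iffP orP) => -[TM|]; [by left| |by left|].
  by case/imsetP=> S; rewrite !inE => /and3P[SM iS jS ->]; right; exists S.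
case=> S [SM iS jS ->]; right; apply/imsetP; exists S => //.
by rewrite !inE SM iS jS.
Qed.

(** The parity is the sign in [det_replace_col]. Since it is the same for all bases to be exchanged,
    the coefficient [(-1) ^+ b] makes every extra term a minor of [A], hence nonnegative, and
    nothing cancels. *)
Lemma Qnk_bridge (R : realType) (n k : nat) (M : {set {set 'I_n}}) (i j : 'I_n)
    (b : bool) :
  Qnk R k M -> i != j ->
  (forall S, S \in M -> i \in S -> j \notin S ->
     odd #|[set x in S :\ i | (x < i)%N]| (+) odd #|[set x in S :\ i | (x < j)%N]|
     = b) ->
  Qnk R k (bridge M i j).
Proof.
move=> [A [[rA posA] ->]] ij Hb.
pose A' := add_col A i j ((-1) ^+ b).
have swapE (f g : {ffun 'I_k -> 'I_n}) : increasing f -> increasing g ->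
    j \in f @: [set: 'I_k] -> i \notin f @: [set: 'I_k] ->
    g @: [set: 'I_k] = i |: (f @: [set: 'I_k] :\ j) ->
    (-1) ^+ b * \det (colsub (fun x => if f x == j then i else f x) A) =
    \det (colsub g A).
  (* A vanishing minor has no sign to check; otherwise the image of [g] is a basis and [Hb]
     applies. *)
  move=> Hf Hg jf nif Eg; case: (eqVneq (\det (colsub g A)) 0) => [g0|g0].
    rewrite (@det_replace_col _ _ _ A f g i j (f @: [set: 'I_k] :\ j)) ?g0 ?mulr0 //.
    - exact/increasingP.
    - exact/increasingP.
    - by rewrite !inE negb_and nif orbT.
    - by rewrite !inE eqxx.
    - by rewrite setD1K.
  have Ui : i \notin f @: [set: 'I_k] :\ j by rewrite !inE negb_and nif orbT.
  have := Hb (g @: [set: 'I_k]); rewrite {2 3 4 5}Eg !inE eqxx setU1K //=.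
  rewrite (negbTE (_ : j != i)) 1?eq_sym // eqxx /= => <- //; last first.
    by apply/imsetP; exists g; rewrite // inE Hg.
  rewrite (@det_replace_col _ _ _ A f g i j (f @: [set: 'I_k] :\ j)) ?mulrA -?signr_addb ?addbb ?mul1r //.
  - exact/increasingP.
  - exact/increasingP.
  - by rewrite !inE eqxx.
  - by rewrite setD1K.
have minorE (f : {ffun 'I_k -> 'I_n}) : increasing f ->
    j \in f @: [set: 'I_k] -> i \notin f @: [set: 'I_k] ->
    exists g : {ffun 'I_k -> 'I_n}, [/\ increasing g,
      g @: [set: 'I_k] = i |: (f @: [set: 'I_k] :\ j) &
      \det (colsub f A') = \det (colsub f A) + \det (colsub g A)].
  move=> Hf jf nif; have If := homo_ltn_inj (increasingP _ Hf).
  have [|g Hg Eg] := @increasing_enum k n (i |: (f @: [set: 'I_k] :\ j)).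
    rewrite cardsU1 !inE negb_and nif orbT.
    by rewrite -[RHS]card_ord -cardsT -(card_imset _ If) [RHS](cardsD1 j) jf.
  exists g; split=> //; rewrite det_add_col // jf nif /=.
  by rewrite (swapE f g).
have minorE0 (f : {ffun 'I_k -> 'I_n}) : increasing f ->
    ~~ ((j \in f @: [set: 'I_k]) && (i \notin f @: [set: 'I_k])) ->
    \det (colsub f A') = \det (colsub f A).
  move=> Hf H; rewrite det_add_col // ?(negbTE H) ?addr0 //.
  exact/homo_ltn_inj/increasingP.
have geA' (f : {ffun 'I_k -> 'I_n}) : increasing f ->
    \det (colsub f A) <= \det (colsub f A').
  move=> Hf; case: (boolP ((j \in f @: [set: 'I_k]) && (i \notin f @: [set: 'I_k]))).
    by case/andP=> jf nif; have [g [Hg _ ->]] := minorE f Hf jf nif; rewrite lerDl posA.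
  by move=> H; rewrite minorE0.
have pos_lt (f : {ffun 'I_k -> 'I_n}) : increasing f -> \det (colsub f A) != 0 ->
    \det (colsub f A') != 0.
  move=> Hf d; apply: lt0r_neq0; apply: lt_le_trans (geA' f Hf).
  by rewrite lt_neqAle eq_sym d posA.
exists A'; split; first split.
- have [f Hf df] := row_free_minor rA; apply: (@minor_row_free _ _ _ _ f); exact: pos_lt.
- by move=> f Hf; apply: le_trans (posA f Hf) (geA' f Hf).
apply/setP=> T; apply/bridgeP/imsetP.
  case=> [/imsetP[f]|[S [/imsetP[g + SE]]]].
    by rewrite inE => /andP[Hf df] ->; exists f; rewrite // inE Hf pos_lt.
  rewrite inE => /andP[Hg dg] iS jS TE.
  have ji : j != i by rewrite eq_sym.
  have [|f Hf Ef] := @increasing_enum k n T.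
    have Ig := homo_ltn_inj (increasingP _ Hg).
    rewrite TE cardsU1 !inE negb_and jS orbT.
    by rewrite -[RHS]card_ord -cardsT -(card_imset _ Ig) -SE [RHS](cardsD1 i) iS.
  exists f => //; rewrite inE Hf /=.
  have jf : j \in f @: [set: 'I_k] by rewrite Ef TE setU11.
  have nif : i \notin f @: [set: 'I_k] by rewrite Ef TE !inE eqxx /= orbF.
  rewrite det_add_col ?jf ?nif //=; last exact/homo_ltn_inj/increasingP.
  rewrite (swapE f g) //; last first.
    have jS' : j \notin S :\ i by rewrite !inE negb_and jS orbT.
    by rewrite Ef TE setU1K // setD1K // SE.
  apply: lt0r_neq0; apply: ltr_wpDl; first exact: posA.
  by rewrite lt_neqAle eq_sym dg posA.
case=> f; rewrite inE => /andP[Hf df] TE.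
case: (boolP ((j \in f @: [set: 'I_k]) && (i \notin f @: [set: 'I_k]))); last first.
  by move=> H; left; apply/imsetP; exists f; rewrite // inE Hf -(minorE0 f).
case/andP=> jf nif; have [g [Hg Eg dfE]] := minorE f Hf jf nif.
case: (eqVneq (\det (colsub f A)) 0) => [f0|f0]; last first.
  by left; apply/imsetP; exists f; rewrite // inE Hf.
right; exists (g @: [set: 'I_k]); rewrite Eg; split.
- by rewrite -Eg; apply/imsetP; exists g; rewrite // inE Hg; move: df; rewrite dfE f0 add0r.
- exact: setU11.
- by rewrite !inE eqxx orbF eq_sym.
- by rewrite setU1K ?setD1K // !inE negb_and nif orbT.
Qed.

(** * Rank two positroids as noncrossing partitions *)

(* betweenness on the line; two chords xy and zw of the circle cross iff
   [btw x y z != btw x y w], and [btw x y z = btw x u z (+) btw u y z] *)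
Definition btw (n : nat) (x y z : 'I_n) : bool := (x < z)%N (+) (y < z)%N.

(** A nonloop is parallel to itself as soon as all bases are pairs, because [[set x; x]] is a
    singleton. *)
Definition par (n : nat) (N : {set {set 'I_n}}) (x y : 'I_n) : bool :=
  [&& x \notin loops N, y \notin loops N & [set x; y] \notin N].

(** In [nc_cross], [z] and [w] need not be parallel to each other. This is stronger than the usual
    noncrossing condition: each class is a cyclic interval of the nonloops. *)
Record noncrossing2 (n : nat) (N : {set {set 'I_n}}) : Prop := Noncrossing2 {
  nc_neq0 : N != set0;
  nc_card : forall B, B \in N -> #|B| = 2;
  nc_trans : forall x y z, par N x y -> par N y z -> par N x z;
  nc_cross : forall x y z w, par N x y -> z \notin loops N -> w \notin loops N ->
    ~~ par N x z -> ~~ par N x w -> btw x y z = btw x y w }.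

Lemma nonloopP (n : nat) (N : {set {set 'I_n}}) (x : 'I_n) :
  reflect (exists2 B, B \in N & x \in B) (x \notin loops N).
Proof.
rewrite inE negb_forall; apply: (iffP existsP) => -[B].
  by rewrite negb_imply negbK => /andP[]; exists B.
by move=> BN xB; exists B; rewrite negb_imply negbK BN.
Qed.

Lemma par_sym (n : nat) (N : {set {set 'I_n}}) (x y : 'I_n) : par N x y = par N y x.
Proof. by rewrite /par andbCA setUC. Qed.

Lemma parN (n : nat) (N : {set {set 'I_n}}) (x y : 'I_n) :
  x \notin loops N -> y \notin loops N -> ~~ par N x y = ([set x; y] \in N).
Proof. by rewrite /par => -> ->; rewrite negbK. Qed.

Lemma parl (n : nat) (N : {set {set 'I_n}}) (x y : 'I_n) : par N x y -> x \notin loops N.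
Proof. by case/and3P. Qed.

Lemma parr (n : nat) (N : {set {set 'I_n}}) (x y : 'I_n) : par N x y -> y \notin loops N.
Proof. by case/and3P. Qed.

Lemma pair_nonloop (n : nat) (N : {set {set 'I_n}}) (x y : 'I_n) : [set x; y] \in N ->
  (x \notin loops N) /\ (y \notin loops N).
Proof.
by move=> xy; split; apply/nonloopP; exists [set x; y]; rewrite ?set21 ?set22.
Qed.

Lemma pair_Npar (n : nat) (N : {set {set 'I_n}}) (x y : 'I_n) : [set x; y] \in N ->
  ~~ par N x y.
Proof. by move=> xy; rewrite /par xy !andbF. Qed.

Section Noncrossing2Theory.
Variables (n : nat) (N : {set {set 'I_n}}).
Hypothesis ncN : noncrossing2 N.

Lemma nc_pairP (B : {set 'I_n}) : B \in N ->
  exists x y, [/\ B = [set x; y], x != y, x \notin loops N, y \notin loops N & ~~ par N x y].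
Proof.
move=> BN; have /eqP/cards2P[x [y [xy BE]]] := nc_card ncN BN.
have BN' := BN; rewrite BE in BN'; have [xl yl] := pair_nonloop BN'.
by exists x, y; split=> //; apply: pair_Npar.
Qed.

Lemma nc_pair_neq (x y : 'I_n) : [set x; y] \in N -> x != y.
Proof. by move=> /(nc_card ncN); rewrite cards2; case: eqP. Qed.

Lemma par_refl (x : 'I_n) : x \notin loops N -> par N x x.
Proof.
move=> xl; apply/and3P; split=> //; apply/negP => /(nc_card ncN).
by rewrite setUid cards1.
Qed.

Lemma nc_partner (x : 'I_n) : x \notin loops N -> exists y, [set x; y] \in N.
Proof.
case/nonloopP=> B BN; have [y [z [BE _ _ _ _]]] := nc_pairP BN.
rewrite BE !inE in BN * => /orP[]/eqP->; first by exists z.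
by exists y; rewrite setUC.
Qed.

Lemma par_congr (x y z : 'I_n) : par N x y -> par N x z = par N y z.
Proof.
move=> xy; apply/idP/idP; apply: (nc_trans ncN) => //.
by rewrite par_sym.
Qed.

End Noncrossing2Theory.

(** * Rank two minors and total nonnegativity *)

Definition minor2 (R : comNzRingType) (n : nat) (A : 'M[R]_(2, n)) (x y : 'I_n) : R :=
  A 0 x * A 1 y - A 1 x * A 0 y.

Lemma det_colsub2 (R : comNzRingType) (n : nat) (A : 'M[R]_(2, n)) (f : 'I_2 -> 'I_n) :
  \det (colsub f A) = minor2 A (f 0) (f 1).
Proof.
rewrite (expand_det_row _ ord0) !big_ord_recl big_ord0 /cofactor !det_mx11 !mxE.
have E1 : lift ord0 ord0 = 1 :> 'I_2 by apply: ord_inj.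
have E0 : lift (1 : 'I_2) ord0 = 0 by apply: ord_inj.
have E00 : ord0 = 0 :> 'I_2 by [].
by rewrite E1 E0 E00 /minor2 /= expr0 expr1; ring.
Qed.

Lemma imset_ord2 (n : nat) (f : 'I_2 -> 'I_n) : f @: [set: 'I_2] = [set f 0; f 1].
Proof.
apply/setP=> x; rewrite !inE; apply/imsetP/orP => [[i _ ->]|].
  by case: i => [[|[|//]]] i2; [left|right]; apply/eqP; congr f; apply: ord_inj.
by case=> /eqP->; eexists.
Qed.

Lemma minor2C (R : comNzRingType) (n : nat) (A : 'M[R]_(2, n)) (x y : 'I_n) :
  minor2 A x y = - minor2 A y x.
Proof. by rewrite /minor2; ring. Qed.

(** The three-term Pluecker relation. *)
Lemma pluecker2 (R : comNzRingType) (n : nat) (A : 'M[R]_(2, n)) (x y z w : 'I_n) :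
  minor2 A x z * minor2 A y w =
  minor2 A x y * minor2 A z w + minor2 A x w * minor2 A y z.
Proof. by rewrite /minor2; ring. Qed.

Lemma increasing2 (n : nat) (x y : 'I_n) : (x < y)%N ->
  exists2 f : {ffun 'I_2 -> 'I_n}, increasing f & f 0 = x /\ f 1 = y.
Proof.
move=> xy; exists [ffun i => if i == 0 then x else y]; last by rewrite !ffunE.
apply/increasingP=> -[[|[|//]] i2] [[|[|//]] j2] //= _.
by rewrite !ffunE.
Qed.

Lemma pair_matroid_of (R : realType) (n : nat) (A : 'M[R]_(2, n)) (x y : 'I_n) :
  ([set x; y] \in matroid_of A) = (minor2 A x y != 0).
Proof.
apply/imsetP/idP => [[f]|d].
  rewrite inE det_colsub2 imset_ord2 => /andP[_ d] /setP E.
  have := E x; have := E y; have := E (f 0); have := E (f 1).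
  rewrite !inE !eqxx ?orbT /=.
  case/orP=> /eqP f1; case/orP=> /eqP f0 _ _; move: d; rewrite f0 f1 //.
  - by rewrite /minor2 mulrC subrr eqxx.
  - by rewrite minor2C oppr_eq0.
  - by rewrite /minor2 mulrC subrr eqxx.
wlog xy : x y d / (x < y)%N.
  move=> H; case: (ltngtP x y) => [xy|yx|/ord_inj E]; first exact: H.
    by rewrite setUC; apply: H; rewrite // minor2C oppr_eq0.
  by move: d; rewrite /minor2 E mulrC subrr eqxx.
have [f If [f0 f1]] := increasing2 xy.
by exists f; rewrite ?imset_ord2 ?f0 ?f1 // inE If det_colsub2 f0 f1.
Qed.

(** If a chord joining parallel [x] and [y] separated two nonloops outside their class, the Pluecker
    relation for the four points would have one term zero and the other two of incompatible
    signs. *)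
Lemma Qn2_noncrossing (R : realType) (n : nat) (N : {set {set 'I_n}}) :
  Qnk R 2 N -> noncrossing2 N.
Proof.
move=> QN; have [N0 N2] := QnkP QN; case: QN => A [[rA posA] NE].
have pE x y : ([set x; y] \in N) = (minor2 A x y != 0) by rewrite NE pair_matroid_of.
have pos (x y : 'I_n) : (x < y)%N -> 0 <= minor2 A x y.
  move=> xy; have [f If [<- <-]] := increasing2 xy.
  by rewrite -det_colsub2 posA.
have partner x : x \notin loops N -> exists y, minor2 A x y != 0.
  case/nonloopP=> B BN; have /eqP/cards2P[y [z [_ BE]]] := N2 _ BN.
  rewrite {}BE !inE in BN * => /orP[]/eqP->; first by exists z; rewrite -pE.
  by exists y; rewrite -pE setUC.
have tr x y z : par N x y -> par N y z -> par N x z.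
  case/and3P=> xl yl; rewrite pE negbK => /eqP xy /and3P[_ zl].
  rewrite pE negbK => /eqP yz; apply/and3P; split=> //.
  (* With [w] a partner of [y], the relation leaves [minor2 A x z * minor2 A y w = 0], whose second
     factor is nonzero. *)
  rewrite pE negbK; have [w yw] := partner y yl.
  have := pluecker2 A x y z w; rewrite xy yz mul0r mulr0 addr0 => /eqP.
  by rewrite mulf_eq0 (negbTE yw) orbF.
split=> // x y z w pxy zl wl nxz nxw.
have xl := parl pxy; have yl := parr pxy.
wlog xy : x y pxy nxz nxw xl yl / (x < y)%N.
  move=> H; case: (ltngtP x y) => [xy|yx|/ord_inj E]; first exact: H.
    rewrite /btw addbC [RHS]addbC; apply: H => //; first by rewrite par_sym.
      by apply: contra nxz; apply: tr.
    by apply: contra nxw; apply: tr.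
  by rewrite /btw E !addbb.
(* If neither [z] nor [w] lies strictly between [x] and [y], both sides of the equation are
   false. *)
wlog zi : z w zl wl nxz nxw / (x < z < y)%N.
  move=> H; rewrite /btw.
  case: (boolP (x < z < y)%N) => [zi|zi]; first exact: (H z w).
  case: (boolP (x < w < y)%N) => [wi|wi]; first by symmetry; apply: (H w z).
  have zx : z != x :> nat.
    by apply: contraNneq nxz => /ord_inj ->; rewrite /par xl pE negbK /minor2 mulrC subrr eqxx.
  have wx : w != x :> nat.
    by apply: contraNneq nxw => /ord_inj ->; rewrite /par xl pE negbK /minor2 mulrC subrr eqxx.
  have zy : z != y :> nat by apply: contraNneq nxz => /ord_inj ->.
  have wy : w != y :> nat by apply: contraNneq nxw => /ord_inj ->.
  lia.
case/andP: zi => xz zy.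
have [wi|wi] := boolP (x < w < y)%N; first by rewrite /btw; lia.
exfalso.
have nzy : ~~ par N z y by apply: contra nxz => zy'; apply: (tr _ y); rewrite // par_sym.
have nwy : ~~ par N w y by apply: contra nxw => wy'; apply: (tr _ y); rewrite // par_sym.
move: nxz nxw nzy nwy pxy; rewrite /par xl yl zl wl !negbK /= !pE negbK.
move=> nxz nxw nzy nwy /eqP dxy.
have lt0 (u v : 'I_n) : (u < v)%N -> minor2 A u v != 0 -> 0 < minor2 A u v.
  by move=> uv d; rewrite lt_neqAle eq_sym d pos.
have p1 := lt0 _ _ xz nxz; have p2 := lt0 _ _ zy nzy.
have wx : w != x :> nat.
  by apply: contraNneq nxw => /ord_inj ->; rewrite /minor2 mulrC subrr eqxx.
have wy : w != y :> nat.
  by apply: contraNneq nwy => /ord_inj ->; rewrite /minor2 mulrC subrr eqxx.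
have [yw|wx'] : (y < w)%N \/ (w < x)%N.
  by move: wi wx wy xy; clear; lia.
  have p3 : 0 < minor2 A y w by apply: lt0; rewrite // minor2C oppr_eq0.
  have p4 : 0 < minor2 A x w by apply: lt0; rewrite // (ltn_trans xy).
  have := pluecker2 A x y z w; rewrite dxy (minor2C A y z) mul0r.
  have := mulr_gt0 p1 p3; have := mulr_gt0 p4 p2; lra.
have p3 : 0 < minor2 A w y by apply: lt0; rewrite // (ltn_trans wx').
have p4 : 0 < minor2 A w x by apply: lt0; rewrite // minor2C oppr_eq0.
have := pluecker2 A w x z y; rewrite dxy mulr0.
have := mulr_gt0 p4 p2; have := mulr_gt0 p3 p1; lra.
Qed.

(** The least element of the class in the linear order, so that [#|reps N|] counts the classes. A
    loop is its own [rep] by the default of [arg min], hence the extra condition in [reps]. *)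
Definition rep (n : nat) (N : {set {set 'I_n}}) (x : 'I_n) : 'I_n :=
  [arg min_(y < x | par N x y) (y : nat)].

Definition reps (n : nat) (N : {set {set 'I_n}}) : {set 'I_n} :=
  [set x | (x \notin loops N) && (rep N x == x)].

Section Representatives.
Variables (n : nat) (N : {set {set 'I_n}}).
Hypothesis ncN : noncrossing2 N.

Lemma par_rep (x : 'I_n) : x \notin loops N -> par N x (rep N x).
Proof. by move=> xl; rewrite /rep; case: arg_minnP => //; apply: par_refl. Qed.

Lemma rep_le (x y : 'I_n) : par N x y -> (rep N x <= y)%N.
Proof.
move=> xy; rewrite /rep; case: arg_minnP => [|z _]; last exact.
exact/(par_refl ncN)/(parl xy).
Qed.

Lemma eq_rep (x y : 'I_n) : x \notin loops N -> y \notin loops N ->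
  (rep N x == rep N y) = par N x y.
Proof.
move=> xl yl; apply/eqP/idP => [E|xy].
  by apply: (nc_trans ncN (par_rep xl)); rewrite E par_sym par_rep.
have le a b : par N a b -> (rep N a <= rep N b)%N.
  by move=> ab; apply/rep_le/(nc_trans ncN ab)/par_rep/(parr ab).
by apply/ord_inj/eqP; rewrite eqn_leq !le // par_sym.
Qed.

Lemma rep_in (x : 'I_n) : x \notin loops N -> rep N x \in reps N.
Proof.
move=> xl; have px := par_rep xl; rewrite inE (parr px) /=.
by rewrite eq_rep ?(parr px) // par_sym.
Qed.

(** Pairwise nonparallel elements have different representatives. All lower bounds on numbers of
    classes below come from this. *)
Lemma clique_le_reps (X : {set 'I_n}) :
  (forall x, x \in X -> x \notin loops N) ->
  (forall x y, x \in X -> y \in X -> x != y -> [set x; y] \in N) ->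
  (#|X| <= #|reps N|)%N.
Proof.
move=> Xl cX; rewrite -(card_in_imset (f := rep N) (D := mem X)); last first.
  move=> x y xX yX /eqP; rewrite eq_rep ?Xl // => xy; apply/eqP.
  by apply: contraTT xy => xy; apply/pair_Npar/cX.
apply/subset_leq_card/subsetP=> _ /imsetP[x xX ->].
exact/rep_in/Xl.
Qed.

Lemma reps_nonloop (x : 'I_n) : x \in reps N -> x \notin loops N.
Proof. by rewrite inE => /andP[]. Qed.

Lemma reps_pair (x y : 'I_n) : x \in reps N -> y \in reps N -> x != y -> [set x; y] \in N.
Proof.
rewrite !inE => /andP[xl /eqP rx] /andP[yl /eqP ry].
by rewrite -parN -?eq_rep ?rx ?ry // ?inE.
Qed.

End Representatives.

(* Column x is s (1, rep x), where the sign s is -1 on the part of the class of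
   the first nonloop which comes after other classes. *)
Lemma noncrossing_Qn2 (R : realType) (n : nat) (N : {set {set 'I_n}}) :
  noncrossing2 N -> Qnk R 2 N.
Proof.
move=> ncN; have [B0 B0N] := set0Pn _ (nc_neq0 ncN).
have [x0 [y0 [B0E xy0 x0l y0l _]]] := nc_pairP ncN B0N.
(* The class of the first nonloop [a] is the only one that can continue past [n] to the beginning,
   and [wrap] marks its final part. *)
pose a := [arg min_(y < x0 | y \notin loops N) (y : nat)].
have [al amin] : a \notin loops N /\ forall y, y \notin loops N -> (a <= y)%N.
  by rewrite /a; case: arg_minnP.
pose wrap x := par N a x && [exists z : 'I_n, [&& z \notin loops N, (z < x)%N & ~~ par N a z]].
pose s x : R := if x \in loops N then 0 else (-1) ^+ wrap x.
pose A : 'M[R]_(2, n) := \matrix_(i, x) (if i == 0 then s x else s x * (rep N x)%:R).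
have mE x y : minor2 A x y = s x * s y * ((rep N y)%:R - (rep N x)%:R).
  by rewrite /minor2 !mxE /=; ring.
have s0 x : (s x == 0) = (x \in loops N).
  by rewrite /s; case: ifP; rewrite ?eqxx ?signr_eq0.
have m0 x y : (minor2 A x y != 0) = ([set x; y] \in N).
  rewrite mE !mulf_eq0 !s0 !negb_or subr_eq0 eqr_nat.
  case: (boolP (x \in loops N)) => [xl|xl] /=.
    by apply/esym/negbTE/negP => /pair_nonloop[]; rewrite xl.
  case: (boolP (y \in loops N)) => [yl|yl] /=.
    by apply/esym/negbTE/negP => /pair_nonloop[]; rewrite yl.
  by rewrite -parN // par_sym -eq_rep.
have pos (x y : 'I_n) : (x < y)%N -> 0 <= minor2 A x y.
  move=> xy; case: (boolP ([set x; y] \in N)) => [xyN|]; last first.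
    by rewrite -m0 negbK => /eqP->.
  have [xl yl] := pair_nonloop xyN; have npxy := pair_Npar xyN.
  (* Otherwise the chord from [a] to [x] separates [y] from the witness [z] of [wrap x]. *)
  have nwx : wrap x = false.
    apply/negbTE/negP => /andP[ax /existsP[z /and3P[zl zx naz]]].
    have nay : ~~ par N a y by rewrite (par_congr ncN _ ax).
    have := nc_cross ncN ax zl yl naz nay.
    have az : a != z :> nat.
      by apply: contraNneq naz => /ord_inj <-; apply: par_refl.
    have := amin z zl; rewrite /btw; move: az zx xy; clear; lia.
  rewrite mE /s (negbTE xl) (negbTE yl) nwx expr0 mul1r.
  (* If [y] wraps, its representative is at most [a], hence at most that of [x], and the sign -1 of
     column [y] compensates. *)
  have [wy|nwy] := boolP (wrap y).
    rewrite expr1 mulN1r opprB subr_ge0 ler_nat.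
    case/andP: wy => ay _; apply: leq_trans (amin _ (parr (par_rep ncN xl))).
    by apply: rep_le; rewrite // par_sym.
  (* If [rep N y] came before [rep N x], the chord from [rep N y] to [y] would have [x] inside and
     [a] outside. *)
  rewrite expr0 mul1r subr_ge0 ler_nat leqNgt; apply/negP => lt_yx.
  have px := par_rep ncN xl; have py := par_rep ncN yl.
  have rx := rep_le ncN (par_refl ncN xl); have ry := rep_le ncN (par_refl ncN yl).
  have rpy : par N (rep N y) y by rewrite par_sym.
  have nyx : ~~ par N (rep N y) x by rewrite (par_congr ncN _ rpy) par_sym.
  have ya : ~~ par N (rep N y) a.
    apply: contra nwy => ya; rewrite /wrap.
    have ay : par N a y by rewrite (par_congr ncN _ (_ : par N a (rep N y))) // par_sym.
    rewrite ay; apply/existsP; exists x; rewrite xl xy /=.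
    by rewrite (par_congr ncN _ ay) par_sym.
  have := nc_cross ncN rpy xl al nyx ya.
  have ra : rep N y != a :> nat.
    by apply: contraNneq ya => /ord_inj E; rewrite -E par_refl ?(parr py).
  have := amin _ (parr py); rewrite /btw.
  move: ra rx ry lt_yx xy; clear; lia.
have NE : N = matroid_of A.
  apply/setP=> B; apply/idP/idP => [BN|].
    have [x [y [BE _ _ _ _]]] := nc_pairP ncN BN.
    by rewrite BE pair_matroid_of m0 -BE.
  case/imsetP=> f; rewrite inE det_colsub2 imset_ord2 m0.
  by case/andP=> _ fN ->.
exists A; split=> //; split.
  have : B0 \in matroid_of A by rewrite -NE.
  case/imsetP=> f; rewrite inE => /andP[_ d] _.
  exact: minor_row_free d.
move=> f /increasingP If; rewrite det_colsub2; apply: pos.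
exact: If.
Qed.

(** * Intervals and parallel classes *)

Lemma cycposE (n : nat) (a x : 'I_n) :
  ((a <= x)%N /\ cycpos a x = (x - a)%N) \/ ((x < a)%N /\ cycpos a x = (x + n - a)%N).
Proof.
rewrite /cycpos; have := ltn_ord a; have := ltn_ord x.
case: (leqP a x) => [ax|xa] xn an; [left|right]; split=> //.
  have -> : (x + n - a = n + (x - a))%N by lia.
  by rewrite modnDl modn_small //; lia.
by rewrite modn_small //; lia.
Qed.

Lemma ltn_cycpos (n : nat) (a x : 'I_n) : (cycpos a x < n)%N.
Proof. by rewrite /cycpos ltn_pmod // (leq_ltn_trans _ (ltn_ord x)). Qed.

(** Change of origin in the cyclic order, split into cases so that [lia] sees no modulus. *)
Lemma cycpos_shift (n : nat) (z a x : 'I_n) :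
  ((cycpos z a <= cycpos z x)%N /\ cycpos a x = (cycpos z x - cycpos z a)%N) \/
  ((cycpos z x < cycpos z a)%N /\ cycpos a x = (cycpos z x + n - cycpos z a)%N).
Proof.
move: (ltn_ord a) (ltn_ord x) (ltn_ord z).
case: (cycposE z a) => -[? ->]; case: (cycposE z x) => -[? ->];
  case: (cycposE a x) => -[? ->]; lia.
Qed.

(** Going backwards from the common point [w], the left endpoint met first lies in the other
    interval. *)
Lemma cyc_itv_meet (n : nat) (a b a' b' w : 'I_n) :
  w \in cyc_itv a b -> w \in cyc_itv a' b' -> a \in cyc_itv a' b' \/ a' \in cyc_itv a b.
Proof.
rewrite !inE => wb wb'; case: (leqP (cycpos a' a) (cycpos a' b')); first by left.
move=> /(leq_ltn_trans wb') wa; right; apply: leq_trans wb; move: wa.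
have := ltn_cycpos a' a; have a0 : cycpos a' a' = 0%N by rewrite /cycpos addKn modnn.
case: (cycpos_shift a' a w) => -[? ->]; case: (cycpos_shift a' a a') => -[? ->]; lia.
Qed.

(** Cutting the circle at [z] makes the interval linear. *)
Lemma cyc_itvE (n : nat) (z a b x : 'I_n) : (cycpos z a <= cycpos z b)%N ->
  (x \in cyc_itv a b) = (cycpos z a <= cycpos z x <= cycpos z b)%N.
Proof.
rewrite inE; move: (ltn_cycpos z x) (ltn_cycpos z b).
case: (cycpos_shift z a x) => -[? ->]; case: (cycpos_shift z a b) => -[? ->]; lia.
Qed.

(** For [z], [a], [x], [b] in this cyclic order, the chords [ab] and [xz] cross. *)
Lemma cycpos_btw (n : nat) (z a x b : 'I_n) : z != a ->
  (cycpos z a < cycpos z x)%N -> (cycpos z x < cycpos z b)%N ->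
  btw a b x != btw a b z /\ btw x z a != btw x z b.
Proof.
rewrite -(inj_eq (@ord_inj n)) /btw.
move: (ltn_ord a) (ltn_ord b) (ltn_ord z) (ltn_ord x).
move: (cycposE z a) (cycposE z b) (cycposE z x).
move: (cycpos _ _) (cycpos _ _) (cycpos _ _).
lia.
Qed.

Section Intervals.
Variables (n : nat) (N : {set {set 'I_n}}).
Hypothesis ncN : noncrossing2 N.

(** Cut the circle at a nonloop [z] outside the class and let [a] and [b] be the extreme elements of
    the class. A nonloop between them but outside the class would be separated from [z] by the chord
    [ab]. *)
Lemma class_hull (r : 'I_n) : r \notin loops N ->
  exists a b, [/\ par N r a, par N r b &
    forall x, x \notin loops N -> (x \in cyc_itv a b) = par N r x].
Proof.
move=> rl; have [z rz] := nc_partner ncN rl.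
have [_ zl] := pair_nonloop rz; have nrz := pair_Npar rz.
pose a := [arg min_(y < r | par N r y) cycpos z y].
pose b := [arg max_(y > r | par N r y) cycpos z y].
have [ra amin] : par N r a /\ forall y, par N r y -> (cycpos z a <= cycpos z y)%N.
  by rewrite /a; case: arg_minnP => //; apply: par_refl.
have [rb bmax] : par N r b /\ forall y, par N r y -> (cycpos z y <= cycpos z b)%N.
  by rewrite /b; case: arg_maxnP => //; apply: par_refl.
exists a, b; split=> // x xl; rewrite (@cyc_itvE _ z); last exact: amin.
apply/idP/idP => [/andP[ax xb]|rx]; last by rewrite amin ?bmax.
apply: contraT => nrx.
have za : z != a by apply: contraNneq nrz => ->.
have inj y : par N r y -> cycpos z x != cycpos z y.
  move=> ry; apply: contraNneq nrx => E; suff -> : x = y by [].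
  apply: ord_inj; move: E (ltn_ord x) (ltn_ord y) (ltn_ord z).
  by move: (cycposE z x) (cycposE z y); clear; lia.
have ax' : (cycpos z a < cycpos z x)%N by rewrite ltn_neqAle eq_sym inj.
have xb' : (cycpos z x < cycpos z b)%N by rewrite ltn_neqAle inj.
have [nbtw _] := cycpos_btw za ax' xb'.
have ab : par N a b by rewrite -(par_congr ncN _ ra).
by rewrite (nc_cross ncN ab xl zl) ?eqxx // -(par_congr ncN _ ra) in nbtw.
Qed.

Lemma in_rank2_matroid (L : {set 'I_n}) (F : {set {set 'I_n}}) (x y : 'I_n) :
  ([set x; y] \in rank2_matroid L F) =
  [&& x != y, x \notin L, y \notin L &
      [forall I in F, ~~ ((x \in I) && (y \in I))]].
Proof.
rewrite inE cards2; case: (boolP (x != y)) => //= _.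
have -> : [disjoint [set x; y] & L] = (x \notin L) && (y \notin L).
  rewrite disjoints_subset; apply/subsetP/andP => [H|[xL yL] z].
    by have := (H x, H y); rewrite !inE !eqxx orbT => -[-> // ->].
  by rewrite !inE => /orP[]/eqP->.
rewrite -andbA; congr [&& _, _ & _]; apply: eq_forallb => I; congr (_ ==> ~~ _).
apply/subsetP/andP => [H|[xI yI] z]; last by rewrite !inE => /orP[]/eqP->.
by split; apply: H; rewrite !inE eqxx ?orbT.
Qed.

Lemma rank2_matroid_card (L : {set 'I_n}) (F : {set {set 'I_n}}) (B : {set 'I_n}) :
  B \in rank2_matroid L F -> #|B| = 2.
Proof. by rewrite inE => /and3P[/eqP]. Qed.

Lemma pair_sets_eq (N1 N2 : {set {set 'I_n}}) :
  (forall B, B \in N1 -> #|B| = 2) -> (forall B, B \in N2 -> #|B| = 2) ->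
  (forall x y, x != y -> ([set x; y] \in N1) = ([set x; y] \in N2)) -> N1 = N2.
Proof.
move=> c1 c2 H; apply/setP=> B.
have [/eqP/cards2P[x [y [xy ->]]]|nB] := eqVneq #|B| 2; first exact: H.
by apply/idP/idP => [/c1|/c2] E; rewrite E eqxx in nB.
Qed.

(** The hulls of all classes, singletons included, form such a family. They are disjoint because, if
    two of them met, an endpoint of one would lie in the other and so belong to both classes. *)
Lemma describes_exists : exists F, describes F N.
Proof.
have H r : exists I, r \in reps N -> exists a b, [/\ I = cyc_itv a b, par N r a, par N r b &
    forall x, x \notin loops N -> (x \in I) = par N r x].
  case: (boolP (r \in reps N)) => [rN|]; last by exists set0.
  have [a [b [ra rb ab]]] := class_hull (reps_nonloop rN).
  by exists (cyc_itv a b) => _; exists a, b.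
have [I HI] := choice H; exists (I @: reps N); apply/and3P; split.
- apply/trivIsetP=> _ _ /imsetP[r rN ->] /imsetP[r' rN' ->] neq.
  have [a [b [IE ra rb ab]]] := HI r rN; have [a' [b' [IE' ra' rb' ab']]] := HI r' rN'.
  have rr' x : par N r x -> par N r' x -> False.
    move=> rx rx'; move: neq; suff -> : r = r' by rewrite eqxx.
    apply: contraTeq (rx) => nrr'.
    have := reps_pair ncN rN rN' nrr'; rewrite (par_congr ncN x (_ : par N r x)) //.
    move/pair_Npar; apply: contra => _.
    by rewrite (par_congr ncN _ rx) par_sym.
  rewrite -setI_eq0; apply: contraT => /set0Pn[w]; rewrite inE => /andP[].
  rewrite IE IE' => w1 w2; case: (cyc_itv_meet w1 w2) => [aI|aI]; exfalso.
    by apply: (rr' a) => //; rewrite -ab' ?IE' // (parr ra).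
  by apply: (rr' a') => //; rewrite -ab ?IE // (parr ra').
- apply/forallP=> J; apply/implyP=> /imsetP[r rN ->].
  have [a [b [-> _ _ _]]] := HI r rN.
  by apply/existsP; exists a; apply/existsP; exists b.
apply/eqP/pair_sets_eq; [exact: nc_card|exact: rank2_matroid_card|].
move=> x y xy; rewrite in_rank2_matroid xy /=; apply/idP/and3P.
  move=> xyN; have [xl yl] := pair_nonloop xyN; split=> //.
  apply/forallP=> J; apply/implyP=> /imsetP[r rN ->].
  have [a [b [_ _ _ rI]]] := HI r rN; rewrite !rI //.
  apply: contraL xyN => /andP[rx ry].
  by have := par_congr ncN y rx; rewrite ry /par => /esym/and3P[].
case=> xl yl /forallP HF; rewrite -parN //; apply/negP => pxy.
have rx := rep_in ncN xl; have px := par_rep ncN xl.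
have [a [b [_ _ _ rI]]] := HI _ rx.
have := HF (I (rep N x)); rewrite imset_f //= !rI //.
by rewrite -!(par_congr ncN _ px) pxy par_refl.
Qed.

Lemma reduced_intervals : reduced (intervals N) N.
Proof.
have [F0 dF0] := describes_exists.
suff [F rF] : exists F, reduced F N.
  by rewrite /intervals; case: pickP => [//|] /(_ F); rewrite rF.
(* A lexicographic minimum of [#|F|] and then [#|cover F|]; the weight [n.+1] works since a cover
   has at most [n] elements. *)
pose m (F : {set {set 'I_n}}) := (#|F| * n.+1 + #|cover F|)%N.
have [F dF Fmin] : exists2 F, describes F N & forall F', describes F' N -> (m F <= m F')%N.
  by have [F] := @arg_minnP _ F0 (fun F => describes F N) m dF0; exists F.
have cov (F' : {set {set 'I_n}}) : (#|cover F'| <= n)%N.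
  by rewrite -[n in (_ <= n)%N]card_ord max_card.
exists F; apply/and3P; split=> //.
  apply/forallP=> F'; apply/implyP=> dF'.
  have := Fmin F' dF'; rewrite /m; have := cov F; have := cov F'; clear; nia.
apply/forallP=> I; apply/implyP=> IF; apply/forallP=> J; apply/implyP.
case/andP=> _ /properP[JI [x xI nxJ]]; apply/negP => dF'.
have [/trivIsetP tF _ _] := and3P dF.
have le1 : (#|J |: (F :\ I)| <= #|F|)%N.
  by rewrite (cardsD1 I F) IF cardsU1 leq_add2r leq_b1.
have lt2 : (#|cover (J |: (F :\ I))| < #|cover F|)%N.
  apply/proper_card/properP; split.
    apply/subsetP=> y /bigcupP[K]; rewrite !inE => /orP[/eqP->|/andP[_ KF]] yK.
      by apply/bigcupP; exists I; rewrite // (subsetP JI).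
    by apply/bigcupP; exists K.
  exists x; first by apply/bigcupP; exists I.
  apply/negP => /bigcupP[K]; rewrite !inE => /orP[/eqP->|/andP[KI KF]] xK.
    by rewrite xK in nxJ.
  by have /pred0P/(_ x) := tF K I KF IF KI; rewrite /= xK xI.
have := Fmin _ dF'; apply/negP; rewrite -ltnNge /m -addnS.
by rewrite leq_add // leq_mul2r le1 orbT.
Qed.

(** Every interval of [F] contains exactly one representative, and every nonloop outside [cover F]
    is a class by itself. This turns [d_rank] and [e_stat] into counts of classes and nonloops. *)
Lemma reduced_card (F : {set {set 'I_n}}) : reduced F N ->
  (#|reps N| + #|cover F :\: loops N| = #|F| + #|~: loops N|)%N.
Proof.
case/and3P=> dF /forallP Fmin _.
have [/trivIsetP tF /forallP itvF /eqP NE] := and3P dF.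
have pairE x y : ([set x; y] \in N) = [&& x != y, x \notin loops N, y \notin loops N &
    [forall I in F, ~~ ((x \in I) && (y \in I))]].
  by rewrite {1}NE in_rank2_matroid.
have parI I x y : I \in F -> x \in I -> y \in I -> x \notin loops N -> y \notin loops N ->
    par N x y.
  move=> IF xI yI xl yl; rewrite /par xl yl pairE xl yl !negb_and !negbK /=.
  by apply/orP; right; apply/existsP; exists I; rewrite IF xI yI.
have clI I x y : I \in F -> x \in I -> par N x y -> y \in I.
  move=> IF xI /and3P[xl yl]; rewrite pairE xl yl !negb_and !negbK /=.
  case/orP=> [/eqP<- //|/existsP[J]]; rewrite negb_imply negbK => /and3P[JF xJ yJ].
  case: (eqVneq I J) => [-> //|IJ]; have /pred0P/(_ x) := tF _ _ IF JF IJ.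
  by rewrite /= xI xJ.
(* An interval consisting of loops could be dropped, contradicting the minimality of [#|F|]. *)
have nlI I : I \in F -> exists2 x, x \in I & x \notin loops N.
  move=> IF; apply/exists_inP; apply: contraT; rewrite negb_exists => /forallP H.
  have : describes (F :\ I) N.
    apply/and3P; split.
    - apply/trivIsetP=> A B; rewrite !inE => /andP[_ AF] /andP[_ BF]; exact: tF.
    - apply/forallP=> J; apply/implyP; rewrite inE => /andP[_ JF].
      exact: (implyP (itvF J)).
    apply/eqP/pair_sets_eq; [exact: nc_card|exact: rank2_matroid_card|].
    move=> x y xy; rewrite pairE in_rank2_matroid.
    do 2!congr (_ && _); case: (boolP (y \in loops N)) => //= yl.
    apply/forallP/forallP => [K J|K J].
      by apply/implyP; rewrite inE => /andP[_ JF]; apply: (implyP (K J)).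
    apply/implyP=> JF; case: (eqVneq J I) => [->|JI].
      by have := H y; rewrite yl andbT => /negbTE ->; rewrite andbF.
    by have /implyP := K J; apply; rewrite !inE JI.
  move=> dF'; have /implyP/(_ dF') := Fmin (F :\ I).
  by rewrite (cardsD1 I F) IF add1n ltnn.
have E1 : #|reps N :&: cover F| = #|F|.
  rewrite -sum1_card -[RHS]sum1_card.
  rewrite (eq_bigl (fun x => (x \in cover F) && (x \in reps N))); last first.
    by move=> x; rewrite inE andbC.
  rewrite big_mkcondr (big_trivIset _ (introT trivIsetP tF)) /=.
  apply: eq_bigr => I IF; have [x xI xl] := nlI I IF.
  have rI := clI _ _ _ IF xI (par_rep ncN xl).
  rewrite (bigD1 (rep N x)) //= (rep_in ncN xl) big1 // => y /andP[yI].
  apply: contraNeq; case: ifP => // yr _.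
  apply: contraT => neq; have := reps_pair ncN yr (rep_in ncN xl) neq.
  by move/pair_Npar; rewrite (parI I) ?(reps_nonloop yr) ?(parr (par_rep ncN xl)).
have E2 : reps N :\: cover F = ~: loops N :\: cover F.
  apply/setP=> x; rewrite inE [in RHS]inE; case: (boolP (x \in cover F)) => //= xF.
  rewrite in_setC; apply/idP/idP => [/reps_nonloop //|xl].
  have := par_rep ncN xl => /and3P[_ rl]; rewrite pairE xl rl /= negb_and negbK.
  case/orP=> [/eqP->|]; first exact: rep_in.
  rewrite negb_forall => /existsP[J]; rewrite negb_imply negbK => /and3P[JF xJ _].
  by case/negP: xF; apply/bigcupP; exists J.
rewrite -(cardsID (cover F) (reps N)) E1 E2 -(cardsID (cover F) (~: loops N)).
by rewrite -!addnA; congr addn; rewrite addnC; congr addn; rewrite setDE setIC.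
Qed.

Lemma d_rankE (k : nat) :
  d_rank k N = (2 * k)%:Z + #|reps N|%:Z + #|~: loops N|%:Z - (2 * n)%:Z.
Proof.
rewrite /d_rank /itv_union; have := reduced_card reduced_intervals.
have := cardsC (loops N); rewrite card_ord; clear; lia.
Qed.

Lemma e_statE (k : nat) : e_stat k N = #|reps N|%:Z + k%:Z - n%:Z.
Proof.
rewrite /e_stat /itv_union; have := reduced_card reduced_intervals.
have := cardsC (loops N); rewrite card_ord.
have -> : cover (intervals N) :|: loops N = loops N :|: (cover (intervals N) :\: loops N).
  by apply/setP=> x; rewrite !in_setU in_setD; case: (x \in loops N); rewrite ?orbT ?orbF.
have -> : #|loops N :|: (cover (intervals N) :\: loops N)| =
    (#|loops N| + #|cover (intervals N) :\: loops N|)%N.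
  have /eqP : loops N :&: (cover (intervals N) :\: loops N) == set0.
    by rewrite -subset0; apply/subsetP=> x /setIP[xl /setDP[_]]; rewrite xl.
  by rewrite cardsU => ->; rewrite cards0 subn0.
by clear; lia.
Qed.

End Intervals.

(** * Realizing rank two positroids by pairs of dual bases *)

Lemma odd_card_addb (T : finType) (U : {set T}) (P Q : pred T) :
  odd #|[set x in U | P x]| (+) odd #|[set x in U | Q x]| =
  odd #|[set x in U | P x (+) Q x]|.
Proof.
rewrite -oddD -!sum1dep_card !big_mkcondr -big_split /=.
have -> : (\sum_(i in U) ((if P i then 1 else 0) + (if Q i then 1 else 0)) =
  \sum_(i in U) (if P i (+) Q i then 1 else 0) + (\sum_(i in U) (P i && Q i)).*2)%N.
  rewrite -muln2 big_distrl -big_split; apply: eq_bigr => x _.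
  by case: (P x); case: (Q x).
by rewrite oddD odd_double addbF.
Qed.

(** The parity in [Qnk_bridge] counts the elements of [S] strictly between [x] and [j]. The elements
    between that are missing from [S] are either all of [~: S :\ j] or none, according to [b], so
    the parity does not depend on [S]. *)
Lemma Qnk_bridge_btw (R : realType) (n k : nat) (M : {set {set 'I_n}})
    (W : {set 'I_n}) (x j : 'I_n) (b : bool) :
  Qnk R k M -> (forall S, S \in M -> ~: S \subset x |: W) -> x != j ->
  (forall z, z \in W -> z != j -> btw x j z = b) ->
  Qnk R k (bridge M x j).
Proof.
move=> QM MW xj Hb; have [_ cM] := QnkP QM.
pose K := [set u | [&& u != x, u != j & btw x j u]].
apply: (Qnk_bridge (b := odd #|K| (+) (b && odd (n - k - 1)))) => // S SM xS jS.
rewrite odd_card_addb.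
have -> : [set u in S :\ x | (u < x)%N (+) (u < j)%N] = [set u in S :\ x | btw x j u].
  apply/setP=> u; rewrite !inE; case: (eqVneq u x) => //= ux.
  case: (boolP (u \in S)) => //= uS; rewrite /btw.
  have uj : u != j by apply: contraNneq jS => <-.
  move: ux uj; rewrite -!(inj_eq (@ord_inj n)); clear; lia.
rewrite -(cardsID S K) oddD.
have -> : K :&: S = [set u in S :\ x | btw x j u].
  apply/setP=> u; rewrite !inE; case: (eqVneq u j) => [->|_].
    by rewrite (negbTE jS) !andbF.
  by case: (u != x); case: (u \in S); rewrite ?andbT ?andbF.
have -> : #|K :\: S| = (b * (n - k - 1))%N.
  have cT : #|~: S :\ j| = (n - k - 1)%N.
    have <- : #|~: S| = (n - k)%N by rewrite cardsCs setCK card_ord (cM S SM).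
    by rewrite [in RHS](cardsD1 j) inE jS add1n subn1.
  have KS u : (u \in K :\: S) = (u \in ~: S :\ j) && b.
    rewrite !inE; case: (boolP (u \in S)) => uS; rewrite ?andbF //= !andbT.
    have ux : u != x by apply: contraNneq uS => ->.
    rewrite ux /=; case: (eqVneq u j) => //= uj.
    apply: Hb => //; have /subsetP/(_ u) := MW S SM.
    by rewrite !inE uS (negbTE ux) => /(_ isT).
  case: b {Hb} KS => KS; rewrite ?mul1n ?mul0n.
    by rewrite -cT; apply: eq_card => u; rewrite KS andbT.
  by apply/eqP; rewrite cards_eq0; apply/eqP/setP => u; rewrite KS andbF inE.
by rewrite -addbA oddM oddb addbb addbF.
Qed.

Lemma pair_down2 (n : nat) (M : {set {set 'I_n}}) (x y : 'I_n) :
  reflect (x != y /\ exists S, [/\ S \in M, x \notin S & y \notin S])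
          ([set x; y] \in down2 M).
Proof.
rewrite inE cards2; apply: (iffP andP) => -[xy].
  move=> /existsP[J /andP[/imsetP[S SM ->]]]; rewrite subUset !sub1set !inE => /andP[xS yS].
  by split; [case: (x != y) xy|exists S].
case=> S [SM xS yS]; rewrite xy; split=> //; apply/existsP; exists (~: S).
by rewrite imset_f // subUset !sub1set !inE xS yS.
Qed.

Lemma down2_card (n : nat) (M : {set {set 'I_n}}) (B : {set 'I_n}) :
  B \in down2 M -> #|B| = 2.
Proof. by rewrite inE => /andP[/eqP]. Qed.

Lemma bridge_supp (n : nat) (M : {set {set 'I_n}}) (W : {set 'I_n}) (x j : 'I_n) :
  (forall S, S \in M -> ~: S \subset x |: W) ->
  forall S, S \in bridge M x j -> ~: S \subset x |: W.
Proof.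
move=> MW S /bridgeP[/MW //|[T [TM xT jT ->]]]; apply/subsetP=> u.
rewrite !inE negb_or negb_and negbK => /andP[_ /orP[->//|uT]].
by have /subsetP/(_ u) := MW T TM; rewrite !inE uT => /(_ isT).
Qed.

(** [j] is the first element of [W] after [x] and [j'] the last before it. No element of [W] lies
    between [x] and such a neighbour, so the rest of [W] is on one side of the chord joining
    them. *)
Lemma cyclic_neighbours (n : nat) (W : {set 'I_n}) (x s : 'I_n) :
  x \notin W -> s \in W -> exists j j' b b', [/\ j \in W, j' \in W,
    forall z, z \in W -> (cycpos x j <= cycpos x z <= cycpos x j')%N,
    forall z, z \in W -> z != j -> btw x j z = b &
    forall z, z \in W -> z != j' -> btw x j' z = b'].
Proof.
move=> xW sW.
pose j := [arg min_(y < s | y \in W) cycpos x y].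
pose j' := [arg max_(y > s | y \in W) cycpos x y].
have [jW jmin] : j \in W /\ forall y, y \in W -> (cycpos x j <= cycpos x y)%N.
  by rewrite /j; case: arg_minnP.
have [jW' jmax] : j' \in W /\ forall y, y \in W -> (cycpos x y <= cycpos x j')%N.
  by rewrite /j'; case: arg_maxnP.
have xz z : z \in W -> x != z :> nat.
  by move=> zW; apply: contraNneq xW => /ord_inj ->.
exists j, j', (j < x)%N, (x < j')%N; split=> // z zW.
- by rewrite jmin ?jmax.
- rewrite -(inj_eq (@ord_inj n)) => zj; have := jmin z zW; rewrite /btw.
  move: zj (xz z zW) (xz j jW) (ltn_ord x) (ltn_ord z) (ltn_ord j).
  by move: (cycposE x z) (cycposE x j); clear; lia.
rewrite -(inj_eq (@ord_inj n)) => zj; have := jmax z zW; rewrite /btw.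
move: zj (xz z zW) (xz j' jW') (ltn_ord x) (ltn_ord z) (ltn_ord j').
by move: (cycposE x z) (cycposE x j'); clear; lia.
Qed.

Lemma cycpos_inj (n : nat) (a : 'I_n) : injective (cycpos a).
Proof.
move=> x y E; apply: ord_inj; move: E (ltn_ord x) (ltn_ord y) (ltn_ord a).
by move: (cycposE a x) (cycposE a y); clear; lia.
Qed.

(** The invariant of the construction: elements outside [W] lie in every basis of [M], i.e. they are
    loops of the dual, and [down2 M] is the restriction of [N] to [W]. *)
Definition realizes (R : realType) (n k : nat) (N : {set {set 'I_n}}) (W : {set 'I_n})
    (M : {set {set 'I_n}}) : Prop :=
  [/\ Qnk R k M, forall S, S \in M -> ~: S \subset W &
      down2 M = [set B in N | B \subset W]].

Section Realization.
Variables (R : realType) (n k : nat) (N : {set {set 'I_n}}).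
Hypothesis ncN : noncrossing2 N.

Lemma realizes_pair (W : {set 'I_n}) (M : {set {set 'I_n}}) (x y : 'I_n) (S : {set 'I_n}) :
  realizes R k N W M -> S \in M -> x \notin S -> y \notin S -> x != y ->
  [/\ [set x; y] \in N, x \in W & y \in W].
Proof.
case=> _ _ E SM xS yS xy.
have : [set x; y] \in down2 M by apply/pair_down2; split=> //; exists S.
by rewrite E inE subUset !sub1set => /and3P.
Qed.

Lemma realizes_basis (W : {set 'I_n}) (M : {set {set 'I_n}}) (x y : 'I_n) :
  realizes R k N W M -> [set x; y] \in N -> x \in W -> y \in W ->
  exists S, [/\ S \in M, x \notin S & y \notin S].
Proof.
case=> _ _ E xyN xW yW.
have : [set x; y] \in down2 M by rewrite E inE xyN subUset !sub1set xW.
by case/pair_down2.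
Qed.

(** Only pairs containing [x] remain to be checked: by [MM'] and [low], the pairs avoiding [x] that
    miss a basis are the same for [M] and [M']. *)
Lemma realizes_step_aux (W : {set 'I_n}) (x : 'I_n) (M M' : {set {set 'I_n}}) :
  realizes R k N W M -> x \notin loops N -> x \notin W ->
  Qnk R k M' -> M \subset M' ->
  (forall S, S \in M' -> exists2 S0, S0 \in M & S0 \subset x |: S) ->
  (forall S, S \in M' -> ~: S \subset x |: W) ->
  (forall z S, z != x -> S \in M' -> x \notin S -> z \notin S -> [set x; z] \in N) ->
  (forall z, z \in W -> [set x; z] \in N ->
     exists S, [/\ S \in M', x \notin S & z \notin S]) ->
  realizes R k N (x |: W) M'.
Proof.
move=> rM xl xW QM' MM' low supp up1 up2; split=> //.
apply: pair_sets_eq; [exact: down2_card|by move=> B; rewrite inE => /andP[/(nc_card ncN)]|].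
move=> a b ab; rewrite [RHS]inE subUset !sub1set.
wlog xb : a b ab / b != x.
  move=> H; case: (eqVneq b x) => [bx|]; last exact: H.
  by rewrite setUC H ?(andbC (b \in _)) // ?bx // -?bx ?ab // eq_sym.
apply/pair_down2/and3P => [[_ [S [SM aS bS]]]|[abN aW bW]].
  have [aW bW] : a \in x |: W /\ b \in x |: W.
    by split; apply: (subsetP (supp S SM)); rewrite inE.
  split=> //; case: (eqVneq a x) => [ax|ax]; first by rewrite ax in aS *; apply: (up1 b S).
  have [S0 S0M S0S] := low S SM.
  have [] := realizes_pair rM S0M _ _ ab => //; apply/negP => /(subsetP S0S).
    by rewrite !inE (negbTE ax) (negbTE aS).
  by rewrite !inE (negbTE xb) (negbTE bS).
split=> //; rewrite !inE (negbTE xb) /= in bW.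
case: (eqVneq a x) => [ax|ax]; first by rewrite ax in abN *; apply: up2.
rewrite !inE (negbTE ax) /= in aW.
have [S [SM aS bS]] := realizes_basis rM abN aW bW.
by exists S; rewrite (subsetP MM').
Qed.

(** Bases missing [x] arise by exchange from those missing a neighbour. One neighbour parallel to
    [x] gives [x] the right pairs; if [x] starts a new class, the two neighbours together pair [x]
    with all of [W]. The pair [s], [t] witnesses that [W] meets two classes. *)
Lemma realizes_step (W : {set 'I_n}) (x s t : 'I_n) (M : {set {set 'I_n}}) :
  realizes R k N W M -> W \subset ~: loops N -> x \notin loops N -> x \notin W ->
  s \in W -> t \in W -> [set s; t] \in N ->
  exists M', realizes R k N (x |: W) M'.
Proof.
move=> rM Wl xl xW sW tW st; have [QM supp _] := rM.
have Wl' z : z \in W -> z \notin loops N by move/(subsetP Wl); rewrite inE.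
have xM S : S \in M -> x \in S.
  by move=> SM; apply: contraNT xW => xS; apply: (subsetP (supp S SM)); rewrite inE.
have xN z : z \in W -> ([set x; z] \in N) = ~~ par N x z.
  by move=> zW; rewrite (parN xl (Wl' z zW)).
have suppx S : S \in M -> ~: S \subset x |: W.
  by move=> SM; apply: subset_trans (supp S SM) (subsetUr _ _).
have [j [j' [b [b' [jW jW' jj Hj Hj']]]]] := cyclic_neighbours xW sW.
have xj : x != j by apply: contraNneq xW => ->.
have xj' : x != j' by apply: contraNneq xW => ->.
have lt z z' : z \in W -> z' \in W -> z != z' -> (cycpos x z != cycpos x z').
  by move=> _ _; rewrite (inj_eq (@cycpos_inj _ x)).
have low1 i S : S \in bridge M x i -> exists2 S0, S0 \in M & S0 \subset x |: S.
  case/bridgeP=> [SM|[S0 [S0M _ _ ->]]]; first by exists S; rewrite // subsetUr.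
  exists S0 => //; apply/subsetP=> u uS; rewrite !inE uS.
  by case: (u == x); rewrite ?orbT.
have [/exists_inP[p pW xp]|npar] := boolP [exists p in W, par N x p].
  (* If neither neighbour were in the class of [x], the chord from [x] to [p] would separate
     them. *)
  have [i [c [iW xpi Hi]]] : exists i c, [/\ i \in W, par N x i &
      forall z, z \in W -> z != i -> btw x i z = c].
    case: (boolP (par N x j)) => [xpj|nj]; first by exists j, b.
    case: (boolP (par N x j')) => [xpj|nj']; first by exists j', b'.
    have pj : p != j by apply: contraNneq nj => <-.
    have pj' : p != j' by apply: contraNneq nj' => <-.
    have /andP[le1 le2] := jj p pW.
    have ltp : (cycpos x j < cycpos x p)%N by rewrite ltn_neqAle le1 lt // eq_sym.
    have gtp : (cycpos x p < cycpos x j')%N by rewrite ltn_neqAle le2 lt.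
    have [_] := cycpos_btw xj ltp gtp; rewrite par_sym in xp.
    have nj2 : ~~ par N p j by rewrite (par_congr ncN _ xp).
    have nj2' : ~~ par N p j' by rewrite (par_congr ncN _ xp).
    by rewrite (nc_cross ncN xp (Wl' _ jW) (Wl' _ jW') nj2 nj2') eqxx.
  have xi : x != i by apply: contraNneq xW => ->.
  exists (bridge M x i); apply: (realizes_step_aux rM) => //.
  - exact: (Qnk_bridge_btw QM suppx xi Hi).
  - exact: subsetUl.
  - exact: low1.
  - exact: bridge_supp.
  - move=> z S zx /bridgeP[SM|[S0 [S0M _ iS0 ->]]]; first by rewrite xM.
    move=> _; rewrite !inE zx negb_or => /andP[zi zS0].
    rewrite eq_sym in zi; have [izN _ zW] := realizes_pair rM S0M iS0 zS0 zi.
    rewrite xN // (par_congr ncN _ xpi); exact: pair_Npar.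
  move=> z zW; rewrite xN // (par_congr ncN _ xpi) parN ?Wl' // => izN.
  have [S [SM iS zS]] := realizes_basis rM izN iW zW.
  have iz := nc_pair_neq ncN izN.
  exists (i |: (S :\ x)); split.
  - by apply/bridgeP; right; exists S; split=> //; apply: xM.
  - by rewrite !inE eqxx orbF.
  - by rewrite !inE (negbTE zS) andbF orbF eq_sym.
have npx z : z \in W -> ~~ par N x z.
  by move=> zW; apply: contra npar => xz; apply/exists_inP; exists z.
(* If the neighbours were parallel, any [q] of [W] in another class would be separated from [x] by
   the chord [jj']; so all of [W] would be one class, against [st]. *)
have nxj' : ~~ par N j j'.
  apply/negP => pjj; have Wj q : q \in W -> par N j q.
    move=> qW; apply: contraT => njq.
    have qj : q != j by apply: contraNneq njq => ->; apply/(par_refl ncN)/Wl'.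
    have qj' : q != j' by apply: contraNneq njq => ->.
    have /andP[le1 le2] := jj q qW.
    have ltq : (cycpos x j < cycpos x q)%N by rewrite ltn_neqAle le1 lt // eq_sym.
    have gtq : (cycpos x q < cycpos x j')%N by rewrite ltn_neqAle le2 lt.
    have [+ _] := cycpos_btw xj ltq gtq.
    rewrite (nc_cross ncN pjj (Wl' _ qW) xl njq) ?eqxx //.
    by rewrite par_sym npx.
  by have := pair_Npar st; rewrite -(par_congr ncN _ (Wj s sW)) Wj.
exists (bridge (bridge M x j) x j'); apply: (realizes_step_aux rM) => //.
- apply: (Qnk_bridge_btw _ (bridge_supp suppx) xj' Hj').
  exact: (Qnk_bridge_btw QM suppx xj Hj).
- exact: subset_trans (subsetUl _ _) (subsetUl _ _).
- move=> S /bridgeP[/low1 //|[S0 [/low1[S1 S1M H] xS _ ->]]].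
  exists S1 => //; apply: subset_trans H _; apply/subsetP=> u.
  by rewrite !inE => /orP[->//|->]; case: (u == x); rewrite ?orbT.
- exact/bridge_supp/bridge_supp.
- move=> z S zx SM _ zS; have := bridge_supp (bridge_supp suppx) SM.
  move/subsetP/(_ z); rewrite !inE zS (negbTE zx) /= => /(_ isT) zW.
  by rewrite xN ?npx.
(* As [j] and [j'] are not parallel, one of them forms a basis with [z], and exchanging [x] for it
   serves the pair of [x] and [z]. *)
move=> z zW _; have [jz|jz] := boolP (par N j z).
  have zj'N : [set j'; z] \in N.
    by rewrite -parN ?Wl' // par_sym -(par_congr ncN _ jz).
  have [S [SM jS zS]] := realizes_basis rM zj'N jW' zW.
  exists (j' |: (S :\ x)); split.
  - by apply/bridgeP; right; exists S; split; rewrite ?xM //; apply/bridgeP; left.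
  - by rewrite !inE eqxx orbF.
  - rewrite !inE (negbTE zS) andbF orbF.
    by rewrite eq_sym; exact: (nc_pair_neq ncN zj'N).
have zjN : [set j; z] \in N by rewrite -parN ?Wl'.
have [S [SM jS zS]] := realizes_basis rM zjN jW zW.
exists (j |: (S :\ x)); split.
- apply/bridgeP; left; apply/bridgeP; right; exists S; split=> //; exact: xM.
- by rewrite !inE eqxx orbF.
- rewrite !inE (negbTE zS) andbF orbF.
  by rewrite eq_sym; exact: (nc_pair_neq ncN zjN).
Qed.

(** Induction on the number of elements of [W] outside [X], ending when [W] is the set of all
    nonloops, where the restriction of [N] is [N] itself. *)
Lemma realization : (2 <= n - k)%N -> (k <= n)%N -> (n - k <= #|reps N|)%N ->
  exists2 M, Qnk R k M & down2 M = N.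
Proof.
move=> nk2 kn le_reps.
have [X XR cX] : exists2 X : {set 'I_n}, X \subset reps N & #|X| = (n - k)%N.
  by have /card_geqP[s [us ss sR]] := le_reps; exists [set y in s];
    [apply/subsetP=> y; rewrite inE; apply: sR|rewrite cardsE (card_uniqP us)].
have XN x y : x \in X -> y \in X -> x != y -> [set x; y] \in N.
  by move=> xX yX; apply: reps_pair => //; apply: (subsetP XR).
(* This is where [2 <= n - k] enters: [X] already meets two classes. *)
have [s [t [sX tX st]]] : exists s t, [/\ s \in X, t \in X & [set s; t] \in N].
  have : (1 < #|X|)%N by rewrite cX.
  by case/card_gt1P=> s [t [sX tX st]]; exists s, t; rewrite XN.
have base : realizes R k N X [set ~: X].
  split; first by apply: Qnk_singleton; have := cardsC X; rewrite card_ord; lia.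
    by move=> S; rewrite inE => /eqP->; rewrite setCK.
  apply: pair_sets_eq; [exact: down2_card|by move=> B; rewrite inE => /andP[/(nc_card ncN)]|].
  move=> a b ab; rewrite [RHS]inE subUset !sub1set.
  apply/pair_down2/and3P => [[_ [S []]]|[abN aX bX]].
    by rewrite inE => /eqP->; rewrite !inE !negbK => aX bX; rewrite aX bX XN.
  by split=> //; exists (~: X); rewrite !inE !negbK.
have H m : forall W : {set 'I_n}, #|W :\: X| = m -> X \subset W -> W \subset ~: loops N ->
    exists M, realizes R k N W M.
  elim: m => [|m IH] W cW XW Wl.
    have -> : W = X; last by exists [set ~: X].
    by apply/eqP; rewrite eqEsubset XW andbT -setD_eq0 -cards_eq0 cW.
  have [x] : exists x, x \in W :\: X by apply/set0Pn; rewrite -card_gt0 cW.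
  rewrite inE => /andP[nxX xW].
  have XWx : X \subset W :\ x by rewrite subsetD1 XW.
  have Wxl : W :\ x \subset ~: loops N by apply: subset_trans Wl; apply: subsetDl.
  have [|M rM] := IH (W :\ x) _ XWx Wxl.
    have := cardsD1 x (W :\: X); rewrite cW inE nxX xW add1n => -[->].
    by apply: eq_card => y; rewrite !inE; case: (y == x); rewrite ?andbF.
  rewrite -(setD1K xW); apply: (realizes_step rM (s := s) (t := t)) => //.
  - by have := subsetP Wl x xW; rewrite in_setC.
  - by rewrite !inE eqxx.
  - exact: (subsetP XWx).
  - exact: (subsetP XWx).
have [||M [QM _ E]] := H _ (~: loops N) erefl; rewrite ?subxx //.
  by apply: subset_trans XR _; apply/subsetP=> x /reps_nonloop; rewrite in_setC.
exists M => //; rewrite E; apply/setP=> B; rewrite inE; apply: andb_idr => BN.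
by apply/subsetP=> x xB; rewrite in_setC; apply/nonloopP; exists B.
Qed.

End Realization.

(** * The order on rank two positroids *)

(** The number of classes plus the number of nonloops; on the poset it differs from [d_rank] by a
    constant. *)
Definition rho (n : nat) (N : {set {set 'I_n}}) : nat := (#|reps N| + #|~: loops N|)%N.

Lemma nonloop_sub (n : nat) (N N' : {set {set 'I_n}}) (x : 'I_n) :
  N \subset N' -> x \notin loops N -> x \notin loops N'.
Proof.
move=> sN /nonloopP[B BN xB]; apply/nonloopP; exists B => //.
exact: (subsetP sN).
Qed.

Lemma par_sub (n : nat) (N N' : {set {set 'I_n}}) (x y : 'I_n) :
  N \subset N' -> x \notin loops N -> y \notin loops N -> par N' x y -> par N x y.
Proof.
move=> sN xl yl /and3P[_ _ xyN']; rewrite /par xl yl /=.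
by apply: contra xyN'; apply: (subsetP sN).
Qed.

Lemma card_nonloops_sub (n : nat) (N N' : {set {set 'I_n}}) :
  N \subset N' -> (#|~: loops N| <= #|~: loops N'|)%N.
Proof.
move=> sN; apply/subset_leq_card/subsetP=> x; rewrite !in_setC.
exact: nonloop_sub.
Qed.

Lemma card_reps_sub (n : nat) (N N' : {set {set 'I_n}}) :
  noncrossing2 N -> noncrossing2 N' -> N \subset N' -> (#|reps N| <= #|reps N'|)%N.
Proof.
move=> ncN ncN' sN; apply: (clique_le_reps ncN').
  by move=> x /reps_nonloop; apply: nonloop_sub.
by move=> x y xN yN xy; apply: (subsetP sN); apply: reps_pair.
Qed.

Lemma rho_sub (n : nat) (N N' : {set {set 'I_n}}) :
  noncrossing2 N -> noncrossing2 N' -> N \subset N' -> (rho N <= rho N')%N.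
Proof. by move=> nc nc' sN; rewrite leq_add ?card_reps_sub ?card_nonloops_sub. Qed.

(** Both counts must agree, so the nonloops are the same. A pair in [N'] but not in [N] is parallel
    in [N], and one of its elements is not parallel in [N'] to their common representative [r].
    Adding it to [reps N] gives one class too many in [N']. *)
Lemma rho_inj (n : nat) (N N' : {set {set 'I_n}}) :
  noncrossing2 N -> noncrossing2 N' -> N \subset N' -> (rho N' <= rho N)%N -> N = N'.
Proof.
move=> ncN ncN' sN le_rho.
have := card_nonloops_sub sN; have := card_reps_sub ncN ncN' sN => le_r le_w.
have [ge_r ge_w] : (#|reps N'| <= #|reps N|)%N /\ (#|~: loops N'| <= #|~: loops N|)%N.
  by move: le_rho le_r le_w; rewrite /rho; clear; lia.
have lE : ~: loops N = ~: loops N'.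
  apply/eqP; rewrite eqEcard ge_w andbT.
  by apply/subsetP=> x; rewrite !in_setC; apply: nonloop_sub.
apply/eqP; rewrite eqEsubset sN; apply/subsetP=> B BN'.
have [a [b [BE ab al' bl' _]]] := nc_pairP ncN' BN'.
rewrite BE in BN' *; apply: contraT => nabN.
have al : a \notin loops N by rewrite -in_setC lE in_setC.
have bl : b \notin loops N by rewrite -in_setC lE in_setC.
have pab : par N a b by rewrite /par al bl.
pose r := rep N a; have rN : r \in reps N by apply: rep_in.
have rl' : r \notin loops N' by apply: nonloop_sub sN (reps_nonloop rN).
have [c [cl pac nrc]] : exists c, [/\ c \notin loops N, par N a c & ~~ par N' r c].
  have [pra|nra] := boolP (par N' r a); last by exists a; rewrite par_refl.
  by exists b; split=> //; rewrite (par_congr ncN' _ pra); apply: pair_Npar.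
have cr : par N c r by rewrite -(par_congr ncN _ pac); apply: par_rep.
have ncr : c \notin reps N.
  apply/negP => cN; case: (eqVneq c r) => [E|ncr]; last first.
    by have /pair_Npar := reps_pair ncN cN rN ncr; rewrite cr.
  by move: nrc; rewrite E par_refl.
have : (#|c |: reps N| <= #|reps N'|)%N.
  have cl' := nonloop_sub sN cl.
  have cN' x : x \in reps N -> [set c; x] \in N'.
    move=> xN; case: (eqVneq x r) => [->|xr].
      by rewrite setUC -parN.
    apply: (subsetP sN); rewrite -parN ?(reps_nonloop xN) // (par_congr ncN _ cr) par_sym.
    exact/pair_Npar/reps_pair.
  apply: (clique_le_reps ncN') => [x|x y]; rewrite !in_setU1.
    by case/predU1P=> [-> //|xN]; apply: nonloop_sub sN (reps_nonloop xN).
  case/predU1P=> [->|xN] /predU1P[->|yN].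
  - by rewrite eqxx.
  - by move=> _; apply: cN'.
  - by move=> _; rewrite setUC; apply: cN'.
  by move=> xy; apply: (subsetP sN); apply: reps_pair.
by rewrite cardsU1 ncr ltnNge ge_r.
Qed.

(** * Deletion and merging, which lower [rho] by at most one *)

Definition delete (n : nat) (N : {set {set 'I_n}}) (x : 'I_n) : {set {set 'I_n}} :=
  [set B in N | x \notin B].

Lemma delete_pair (n : nat) (N : {set {set 'I_n}}) (x y z : 'I_n) :
  ([set y; z] \in delete N x) = [&& y != x, z != x & [set y; z] \in N].
Proof. by rewrite !inE negb_or andbC -andbA !(eq_sym x). Qed.

(** The element [x'] takes over the role of [x] both as a partner and as a representative, so no
    class disappears and [x] is the only new loop. *)
Lemma noncrossing_delete (n : nat) (N : {set {set 'I_n}}) (x x' : 'I_n) :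
  noncrossing2 N -> delete N x != set0 -> x' != x -> par N x x' ->
  noncrossing2 (delete N x) /\ (rho N <= (rho (delete N x)).+1)%N.
Proof.
move=> ncN ne xx pxx.
have lE y : (y \notin loops (delete N x)) = (y != x) && (y \notin loops N).
  apply/idP/andP => [|[yx yl]].
    case/nonloopP=> B; rewrite inE => /andP[BN xB] yB; split.
      by apply: contraNneq xB => <-.
    by apply/nonloopP; exists B.
  have [t ytN] := nc_partner ncN yl.
  have [t' [t'x yt'N]] : exists t', t' != x /\ [set y; t'] \in N.
    case: (eqVneq t x) => [tx|]; last by exists t.
    exists x'; split=> //; rewrite -parN ?(parr pxx) // par_sym -(par_congr ncN _ pxx) par_sym.
    by rewrite -tx; apply: pair_Npar.
  by apply/nonloopP; exists [set y; t']; rewrite ?set21 // delete_pair yx t'x.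
have pE y z : par (delete N x) y z = [&& y != x, z != x & par N y z].
  rewrite /par !lE delete_pair; case: (y != x); case: (z != x); rewrite /= ?andbF //.
have ncD : noncrossing2 (delete N x).
  split=> //.
  - by move=> B; rewrite inE => /andP[BN _]; apply: nc_card BN.
  - move=> a b c; rewrite !pE => /and3P[-> _ ab] /and3P[_ -> bc] /=.
    exact: nc_trans bc.
  move=> a b z w; rewrite !pE !lE => /and3P[ax bx ab] /andP[zx zl] /andP[wx wl].
  by rewrite ax zx wx; apply: nc_cross.
split=> //; rewrite /rho -addnS leq_add //.
  pose f r := if r == x then x' else r.
  have fl r : r \notin loops N -> par N r (f r).
    by move=> rl; rewrite /f; case: eqP => [->//|_]; apply: par_refl.
  have fx r : f r != x by rewrite /f; case: (eqVneq r x) => [_|rx].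
  have fN r s : r \in reps N -> s \in reps N -> r != s -> ~~ par N (f r) (f s).
    move=> rN sN rs; have pr := fl _ (reps_nonloop rN); have ps := fl _ (reps_nonloop sN).
    rewrite -(par_congr ncN _ pr) par_sym -(par_congr ncN _ ps) par_sym.
    exact/pair_Npar/reps_pair.
  rewrite -(card_in_imset (f := f) (D := mem (reps N))); last first.
    move=> r s rN sN E; apply: contraTeq isT => rs; have := fN r s rN sN rs.
    by rewrite E par_refl //; apply: parr (fl _ (reps_nonloop sN)).
  apply: (clique_le_reps ncD) => [_ /imsetP[r rN ->]|].
    by rewrite lE fx; apply: parr (fl _ (reps_nonloop rN)).
  move=> _ _ /imsetP[r rN ->] /imsetP[s sN ->] neq.
  rewrite delete_pair !fx /= -parN ?(parr (fl _ (reps_nonloop rN))) //; last first.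
    exact: parr (fl _ (reps_nonloop sN)).
  by apply: fN => //; apply: contraNneq neq => ->.
rewrite (cardsD1 x) -[X in (_ <= X)%N]add1n leq_add ?leq_b1 //.
by apply/subset_leq_card/subsetP=> y; rewrite in_setD1 !in_setC lE.
Qed.

Definition merge (n : nat) (N : {set {set 'I_n}}) (u v : 'I_n) : {set {set 'I_n}} :=
  [set B in N | ~~ (B \subset [set y | par N u y || par N v y])].

Lemma merge_pair (n : nat) (N : {set {set 'I_n}}) (u v y z : 'I_n) :
  ([set y; z] \in merge N u v) =
  ([set y; z] \in N) &&
  ~~ ((par N u y || par N v y) && (par N u z || par N v z)).
Proof. by rewrite inE subUset !sub1set !inE. Qed.

(** The hypothesis on [b] says that [u] and [v] are cyclic neighbours among the nonloops, so the
    union of their classes is again a cyclic interval. *)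
Lemma noncrossing_merge (n : nat) (N : {set {set 'I_n}}) (u v : 'I_n) (b : bool) :
  noncrossing2 N -> merge N u v != set0 -> [set u; v] \in N ->
  (forall z, z \notin loops N -> z != u -> z != v -> btw u v z = b) ->
  noncrossing2 (merge N u v) /\ (rho N <= (rho (merge N u v)).+1)%N.
Proof.
move=> ncN /set0Pn[B0 B0M] uvN Hb; have [ul vl] := pair_nonloop uvN.
pose q y := par N u y || par N v y.
have mE y z : ([set y; z] \in merge N u v) = ([set y; z] \in N) && ~~ (q y && q z).
  exact: merge_pair.
have qpar y z : par N y z -> q y = q z.
  by move=> yz; rewrite /q !(par_sym _ _ y) !(par_sym _ _ z) !(par_congr ncN _ yz).
have ql y : q y -> y \notin loops N by case/orP; apply: parr.
have qs y z : y \notin loops N -> z \notin loops N -> q y != q z -> ~~ par N y z.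
  by move=> _ _; apply: contra => /qpar->.
(* A surviving basis provides a third class, whose element [a] is a partner for everything in the
   merged class. *)
have [a [al nqa]] : exists a, a \notin loops N /\ ~~ q a.
  have : B0 \in N by move: B0M; rewrite inE => /andP[].
  case/(nc_pairP ncN)=> [c [d [BE _ cl dl _]]]; move: B0M; rewrite BE mE => /andP[_].
  by rewrite negb_and => /orP[nq|nq]; [exists c|exists d].
have lE y : (y \notin loops (merge N u v)) = (y \notin loops N).
  apply/idP/idP => [|yl].
    by case/nonloopP=> B; rewrite inE => /andP[BN _] yB; apply/nonloopP; exists B.
  have [t ytN] := nc_partner ncN yl.
  have [t' yt'] : exists t', [set y; t'] \in merge N u v.
    have [qy|nqy] := boolP (q y); last by exists t; rewrite mE ytN (negbTE nqy).
    exists a; rewrite mE (negbTE nqa) andbF andbT -parN //.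
    by apply: qs; rewrite // qy (negbTE nqa).
  by apply/nonloopP; exists [set y; t']; rewrite ?set21.
have pE y z : par (merge N u v) y z = par N y z || (q y && q z).
  rewrite /par !lE mE negb_and negbK.
  have [qy|] := boolP (q y); rewrite /= ?orbF //.
  have [qz|] := boolP (q z); rewrite /= ?orbF //.
  by rewrite (ql _ qy) (ql _ qz) !orbT.
have uv z w : z \notin loops N -> w \notin loops N -> ~~ q z -> ~~ q w ->
    btw u v z = btw u v w.
  have qu : q u by rewrite /q par_refl.
  have qv : q v by rewrite /q (par_refl ncN vl) orbT.
  move=> zl wl nqz nqw; rewrite !Hb //.
  - by apply: contraNneq nqw => ->.
  - by apply: contraNneq nqw => ->.
  - by apply: contraNneq nqz => ->.
  - by apply: contraNneq nqz => ->.
have ncM : noncrossing2 (merge N u v).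
  split.
  - by apply/set0Pn; exists B0.
  - by move=> B; rewrite inE => /andP[BN _]; apply: nc_card BN.
  - move=> x y z; rewrite !pE => /orP[xy|/andP[qx qy]] /orP[yz|/andP[qy' qz]].
    + by rewrite (nc_trans ncN xy yz).
    + by rewrite (qpar _ _ xy) qy' qz orbT.
    + by rewrite qx -(qpar _ _ yz) qy orbT.
    + by rewrite qx qz orbT.
  move=> x y z w; rewrite !pE !lE !negb_or => xy zl wl /andP[nxz nqz] /andP[nxw nqw].
  case/orP: xy => [xy|/andP[qx qy]]; first exact: (nc_cross ncN xy).
  rewrite qx /= in nqz nqw.
  (* A chord inside the merged class is split at [u] or [v] into chords inside old classes and
     possibly the chord [uv]; each piece keeps [z] and [w] on one side, and [btw] is additive. *)
  have toe c : q c -> exists2 e, e = u \/ e = v & btw c e z = btw c e w.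
    move=> qc; have cross e : par N e c -> btw c e z = btw c e w.
      by move=> ec; apply: (nc_cross ncN) => //;
         [rewrite par_sym|apply: qs|apply: qs]; rewrite ?(ql _ qc) // qc ?(negbTE nqz) ?(negbTE nqw).
    by case/orP: (qc) => ec; [exists u|exists v]; auto.
  have [e eE xe] := toe x qx; have [e' eE' ye'] := toe y qy.
  have ee' : btw e e' z = btw e e' w.
    have := uv z w zl wl nqz nqw; rewrite /btw.
    by case: eE => ->; case: eE' => ->; rewrite ?addbb // => uvE; rewrite addbC uvE addbC.
  have split_btw t : btw x y t = btw x e t (+) btw e e' t (+) btw y e' t.
    by rewrite /btw; do 4!case: (_ < _)%N.
  by rewrite !split_btw xe ee' ye'.
split=> //; rewrite /rho -addSn leq_add //; last first.
  by apply/subset_leq_card/subsetP=> y; rewrite !in_setC lE.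
(* Without the representative of [u], the old representatives are still pairwise nonparallel. *)
rewrite (cardsD1 (rep N u)) -add1n leq_add ?leq_b1 //.
apply: (clique_le_reps ncM) => [r|r s].
  by rewrite in_setD1 lE => /andP[_]; apply: reps_nonloop.
rewrite !in_setD1 => /andP[ru rN] /andP[su sN] rs.
have noU c : c \in reps N -> c != rep N u -> ~~ par N u c.
  move=> cN; apply: contra => uc.
  apply: contraT => ncu; have /pair_Npar := reps_pair ncN cN (rep_in ncN ul) ncu.
  by rewrite -(par_congr ncN _ uc) par_rep.
rewrite mE reps_pair //= /q (negbTE (noU r rN ru)) (negbTE (noU s sN su)) /=.
apply/negP => /andP[vr vs]; have /pair_Npar := reps_pair ncN rN sN rs.
by rewrite -(par_congr ncN _ vr) vs.
Qed.

Lemma cycpos_lt_btw (n : nat) (u v z : 'I_n) :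
  (cycpos u v < cycpos u z)%N -> btw u v z = (v < u)%N.
Proof.
rewrite /btw; move: (ltn_ord u) (ltn_ord v) (ltn_ord z).
by case: (cycposE u v) => -[? ->]; case: (cycposE u z) => -[? ->]; lia.
Qed.

(** Among the pairs of [N'] joined by an arc all of whose [N]-nonloops are in one class of [N], take
    one with the shortest arc. A nonloop of [N'] inside it would produce a shorter pair with [u] or
    with [v]. *)
Lemma consecutive_pair (n : nat) (N N' : {set {set 'I_n}}) (x y : 'I_n) :
  noncrossing2 N -> noncrossing2 N' -> N \subset N' ->
  (forall z, z \in loops N -> z \in loops N') ->
  [set x; y] \in N' -> par N x y ->
  exists u v b, [/\ par N u v, [set u; v] \in N' &
    forall z, z \notin loops N' -> z != u -> z != v -> btw u v z = b].
Proof.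
move=> ncN ncN' sN lN xyN' pxy.
have nl z : z \notin loops N' -> z \notin loops N by apply/contra/lN.
pose P (p : 'I_n * 'I_n) := [&& par N p.1 p.2, [set p.1; p.2] \in N' &
  [forall z, (z \notin loops N) && (0 < cycpos p.1 z < cycpos p.1 p.2)%N ==> par N p.1 z]].
(* One of the two arcs between [x] and [y] qualifies: elements of other classes on both arcs would
   be separated by the chord [xy]. *)
have [p0 Pp0] : exists p, P p.
  case: (boolP (P (x, y))) => [|nxy]; first by exists (x, y).
  have pyx : par N y x by rewrite par_sym.
  have yxN' : [set y; x] \in N' by rewrite setUC.
  exists (y, x); move: nxy; rewrite /P /= pxy xyN' pyx yxN' /= negb_forall.
  case/existsP=> z; rewrite negb_imply => /andP[/andP[zl /andP[z0 zy]] nxz].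
  apply/forallP=> w; apply/implyP=> /andP[wl /andP[w0 wx]]; rewrite -(par_congr ncN _ pxy).
  apply: contraT => nxw; have yw : (cycpos x y < cycpos x w)%N.
    have xx : cycpos x x = 0%N by rewrite /cycpos addKn modnn.
    have := ltn_cycpos x y; have := ltn_cycpos x w; move: w0 wx xx; clear.
    by case: (cycpos_shift x y w) => -[? ->]; case: (cycpos_shift x y x) => -[? ->]; lia.
  have xz : x != z by apply: contraTneq z0 => <-; rewrite /cycpos addKn modnn.
  have [_] := cycpos_btw xz zy yw.
  by rewrite /btw addbC [X in _ != X]addbC -!/(btw _ _ _) (nc_cross ncN pxy zl wl nxz nxw) eqxx.
have [[u v] /and3P[/= uv uvN' /forallP arc] pmin] :=
  @arg_minnP _ p0 P (fun p => cycpos p.1 p.2) Pp0.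
exists u, v, (v < u)%N; split=> // z zl zu zv.
apply: cycpos_lt_btw; rewrite ltnNge; apply/negP => le_zv.
have lt_zv : (cycpos u z < cycpos u v)%N by rewrite ltn_neqAle le_zv (inj_eq (@cycpos_inj _ u)) zv.
have uu : cycpos u u = 0%N by rewrite /cycpos addKn modnn.
have z0 : (0 < cycpos u z)%N by rewrite lt0n -uu (inj_eq (@cycpos_inj _ u)).
have uz : par N u z by apply: (implyP (arc z)); rewrite nl // z0.
have [uzN'|nuz] := boolP ([set u; z] \in N').
  have : P (u, z).
    rewrite /P /= uz uzN'; apply/forallP=> w; apply/implyP=> /andP[wl /andP[w0 wz]].
    by apply: (implyP (arc w)); rewrite wl w0 (ltn_trans wz).
  by move/pmin; rewrite /= leqNgt lt_zv.
have [ul vl] := pair_nonloop uvN'.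
have uz' : par N' u z by rewrite /par ul zl.
have : P (z, v).
  rewrite /P /= -!(par_congr ncN _ uz) uv -parN // -(par_congr ncN' _ uz') pair_Npar //=.
  apply/forallP=> w; apply/implyP=> /andP[wl /andP[w0 wv]].
  rewrite -(par_congr ncN _ uz); apply: (implyP (arc w)); rewrite wl /=.
  have := ltn_cycpos u w; have := ltn_cycpos u v; move: w0 wv lt_zv; clear.
  by case: (cycpos_shift u z w) => -[? ->]; case: (cycpos_shift u z v) => -[? ->]; lia.
move/pmin; rewrite /= leqNgt; apply/negP; rewrite negbK.
have := ltn_cycpos u v; move: z0 lt_zv; clear.
by case: (cycpos_shift u z v) => -[? ->]; lia.
Qed.

(** Lower [N'] by one step while staying above [N]: if some loop [x] of [N] is a nonloop of [N'],
    delete it or merge its singleton class with a neighbouring one; otherwise merge two neighbouring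
    classes of [N'] that lie in one class of [N]. *)
Lemma interpolate (n : nat) (N N' : {set {set 'I_n}}) :
  noncrossing2 N -> noncrossing2 N' -> N \proper N' ->
  exists N'', [/\ noncrossing2 N'', N \subset N'', N'' \proper N' &
                  (rho N' <= (rho N'').+1)%N].
Proof.
move=> ncN ncN' /properP[sN [B BN' nBN]].
have byMerge u v b : [set u; v] \in N' ->
    (forall z, z \notin loops N' -> z != u -> z != v -> btw u v z = b) ->
    N \subset merge N' u v ->
    exists N'', [/\ noncrossing2 N'', N \subset N'', N'' \proper N' &
                  (rho N' <= (rho N'').+1)%N].
  move=> uvN' Hb sM; have [ul vl] := pair_nonloop uvN'.
  have [|ncM le_rho] := noncrossing_merge ncN' _ uvN' Hb.
    by apply: contraNneq (nc_neq0 ncN) => E; rewrite -subset0 -E.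
  exists (merge N' u v); split=> //; apply/properP; split.
    by apply/subsetP=> A; rewrite inE => /andP[].
  by exists [set u; v]; rewrite // merge_pair uvN' !par_refl ?orbT.
have [/exists_inP[x xl xl']|] := boolP [exists x in loops N, x \notin loops N'].
  have xN A : A \in N -> x \notin A.
    by move=> AN; apply: contraL xl => xA; apply/nonloopP; exists A.
  have [/existsP[x' /andP[xx' pxx']]|nx] := boolP [exists x', (x' != x) && par N' x x'].
    have sD : N \subset delete N' x.
      by apply/subsetP=> A AN; rewrite inE (subsetP sN) ?xN.
    have [|ncD le_rho] := noncrossing_delete ncN' _ xx' pxx'.
      by apply: contraNneq (nc_neq0 ncN) => E; rewrite -subset0 -E.
    exists (delete N' x); split=> //; apply/properP; split.
      by apply/subsetP=> A; rewrite inE => /andP[].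
    by have [t xt] := nc_partner ncN' xl'; exists [set x; t]; rewrite // delete_pair eqxx.
  have only y : par N' x y -> y = x.
    move=> xy; apply/eqP; apply: contraNT nx => yx.
    by apply/existsP; exists y; rewrite yx.
  have [s xs] := nc_partner ncN' xl'; have [_ sl] := pair_nonloop xs.
  have xs' := nc_pair_neq ncN' xs.
  have xW : x \notin ~: loops N' :\ x by rewrite in_setD1 eqxx.
  have sW : s \in ~: loops N' :\ x by rewrite in_setD1 eq_sym xs' in_setC.
  have [j [_ [b [_ [jW _ _ Hb _]]]]] := cyclic_neighbours xW sW.
  move: jW; rewrite in_setD1 in_setC => /andP[jx jl].
  apply: (byMerge x j b).
  - by rewrite -parN //; apply: contra jx => /only->.
  - by move=> z zl zx zj; apply: Hb; rewrite // in_setD1 zx in_setC.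
  (* No basis of [N] contains [x], so one inside the merged class would lie in the class of [j]. *)
  apply/subsetP=> A AN; have [c [d [AE cd _ _ _]]] := nc_pairP ncN AN.
  have AN' := subsetP sN _ AN; have [cx dx] : c != x /\ d != x.
    by have := xN A AN; rewrite AE in_set2 negb_or !(eq_sym x) => /andP.
  rewrite AE in AN' *.
  rewrite merge_pair AN' /=; apply/negP => /andP[qc qd].
  have jc y : y != x -> par N' x y || par N' j y -> par N' j y.
    by move=> yx /orP[/only E|//]; rewrite E eqxx in yx.
  by have /pair_Npar := AN'; rewrite -(par_congr ncN' _ (jc c cx qc)) jc.
rewrite negb_exists => /forallP sl.
have lN z : z \in loops N -> z \in loops N'.
  by move=> zl; have := sl z; rewrite zl /= negbK.
have nl z : z \notin loops N' -> z \notin loops N by apply/contra/lN.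
have [x [y [BE xy xl yl _]]] := nc_pairP ncN' BN'.
have pxy : par N x y by rewrite /par !nl // -BE.
rewrite BE in BN'; have [u [v [b [puv uvN' Hb]]]] := consecutive_pair ncN ncN' sN lN BN' pxy.
apply: (byMerge u v b) => //; apply/subsetP=> A AN.
have [c [d [AE cd cl dl ncd]]] := nc_pairP ncN AN.
have AN' := subsetP sN _ AN; rewrite AE in AN' *.
rewrite merge_pair AN' /=; apply/negP => /andP[qc qd].
have uc w : w \notin loops N -> par N' u w || par N' v w -> par N u w.
  move=> wl /orP[|/(par_sub sN (parr puv) wl)]; first exact: (par_sub sN (parl puv) wl).
  by rewrite -(par_congr ncN _ puv).
by move: ncd; rewrite -(par_congr ncN _ (uc c cl qc)) uc.
Qed.

(** The uniform matroid of rank 2 on [~: L]: all classes are singletons, so there are as many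
    classes as nonloops. *)
Lemma noncrossing_generic (n : nat) (L : {set 'I_n}) : (2 <= #|~: L|)%N ->
  [/\ noncrossing2 (rank2_matroid L set0), loops (rank2_matroid L set0) = L &
      rho (rank2_matroid L set0) = (2 * #|~: L|)%N].
Proof.
move=> /card_gt1P[s [t [sL tL st]]]; set N := rank2_matroid L set0.
have pairE x y : ([set x; y] \in N) = [&& x != y, x \notin L & y \notin L].
  rewrite in_rank2_matroid; congr (_ && _); rewrite andbA; apply: andb_idr => _.
  by apply/forallP=> I; rewrite inE.
have lE : loops N = L.
  apply/setP=> x; apply/idP/idP; apply: contraLR => xL.
    have [y [yx yL]] : exists y, y != x /\ y \notin L.
      case: (eqVneq s x) => [sx|sx]; last by exists s; rewrite -in_setC.
      by exists t; rewrite -in_setC -sx eq_sym.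
    by apply/nonloopP; exists [set x; y]; rewrite ?set21 // pairE eq_sym yx xL.
  case/nonloopP: xL => B BN; have := BN; rewrite inE => /and3P[_ dBL _] xB.
  by have /pred0P/(_ x) := dBL; rewrite /= xB => /negbT.
have pE x y : par N x y = (x == y) && (x \notin L).
  rewrite /par lE pairE !negb_and !negbK.
  case: eqVneq => [->|] /=; case: (x \in L); case: (y \in L) => //.
have ncN : noncrossing2 N.
  split.
  - by apply/set0Pn; exists [set s; t]; rewrite pairE st -!in_setC sL.
  - exact: rank2_matroid_card.
  - by move=> x y z; rewrite !pE => /andP[/eqP-> _].
  by move=> x y z w; rewrite pE => /andP[/eqP-> _] _ _ _ _; rewrite /btw !addbb.
split=> //; rewrite /rho lE mul2n -addnn; congr (_ + _)%N; apply: eq_card => x.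
apply/idP/idP => [/reps_nonloop|]; rewrite in_setC; first by rewrite lE.
move=> xL; have xl : x \notin loops N by rewrite lE.
rewrite inE xl /=; have := par_rep ncN xl; rewrite pE => /andP[/eqP <- _].
by rewrite eqxx.
Qed.

(** The condition [0 <= e_stat k N] in terms of classes, by [e_statE]; unlike [Pnk] it does not
    mention [R]. *)
Definition many_classes (n k : nat) (N : {set {set 'I_n}}) : Prop :=
  noncrossing2 N /\ (n - k <= #|reps N|)%N.

(** The complement of any basis of [M] is a set of [n - k] pairwise nonparallel elements of [N].
    Conversely [realization] gives [down2 M = N], and [N], being a positroid, is its own
    envelope. *)
Lemma PnkE (R : realType) (n k : nat) : (k + 2 <= n)%N ->
  @Pnk R n k = @many_classes n k.
Proof.
move=> hnk; have nk2 : (2 <= n - k)%N by lia.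
apply/funext => N; apply/propext; split=> [[QN [M [QM [_ sN _]]]]|[ncN le_reps]].
  have ncN := Qn2_noncrossing QN; split=> //.
  have [/set0Pn[J JM] cM] := QnkP QM.
  have cJ : #|~: J| = (n - k)%N by rewrite cardsCs setCK card_ord cM.
  have JN x y : x \in ~: J -> y \in ~: J -> x != y -> [set x; y] \in N.
    rewrite !in_setC => xJ yJ xy; apply: (subsetP sN); apply/pair_down2.
    by split=> //; exists J.
  rewrite -cJ; apply: (clique_le_reps ncN) => // x xJ.
  have /card_gt1P[s [t [sJ tJ st]]] : (1 < #|~: J|)%N by rewrite cJ.
  case: (eqVneq x s) => [->|xs]; first by have /pair_nonloop[] := JN s t sJ tJ st.
  by have /pair_nonloop[] := JN x s xJ sJ xs.
have kn : (k <= n)%N by lia.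
have [M QM ME] := realization R ncN nk2 kn le_reps.
have QN := noncrossing_Qn2 R ncN.
split=> //; exists M; split=> //; rewrite ME; split=> //.
by exists 2.
Qed.

(** * Minimal elements, covers and maximal chains *)

Section RankedPoset.
Variables (n k : nat).
Hypotheses (hnk : (k + 2 <= n)%N).
Local Notation P := (@many_classes n k).
Local Notation generic L := (rank2_matroid (n := n) L set0).

Lemma rho_ge (N : {set {set 'I_n}}) : P N -> (2 * (n - k) <= rho N)%N.
Proof.
case=> ncN le_reps; rewrite mul2n -addnn leq_add // (leq_trans le_reps) //.
by apply/subset_leq_card/subsetP=> x /reps_nonloop; rewrite in_setC.
Qed.

Lemma card_setC_small (L : {set 'I_n}) : #|L| = k -> #|~: L| = (n - k)%N.
Proof. by move=> cL; rewrite cardsCs setCK card_ord cL. Qed.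

Lemma generic_small (L : {set 'I_n}) : #|L| = k ->
  P (generic L) /\ rho (generic L) = (2 * (n - k))%N.
Proof.
move=> cL; have cC := card_setC_small cL.
have [|ncL lL rL] := @noncrossing_generic n L; first by rewrite cC; lia.
split; last by rewrite rL cC.
split=> //; move: rL; rewrite /rho lL cC; lia.
Qed.

(** Keep [n - k] representatives and make everything else a loop. *)
Lemma generic_below (N : {set {set 'I_n}}) : P N ->
  exists2 L : {set 'I_n}, #|L| = k & generic L \subset N.
Proof.
case=> ncN /card_geqP[s [us ss sR]].
have cX : #|[set x in s]| = (n - k)%N by rewrite cardsE (card_uniqP us).
exists (~: [set x in s]); first by rewrite cardsCs setCK card_ord cX; lia.
apply/subsetP=> B BX; have /eqP/cards2P[x [y [xy BE]]] := rank2_matroid_card BX.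
move: BX; rewrite BE in_rank2_matroid !in_setC !negbK !inE => /and4P[_ xs ys _].
by apply: reps_pair; rewrite ?sR.
Qed.

Lemma generic_top : P (generic set0) /\ rho (generic set0) = (2 * n)%N.
Proof.
have cT : #|~: (set0 : {set 'I_n})| = n by rewrite setC0 cardsT card_ord.
have [|ncL lL rL] := @noncrossing_generic n set0; first by rewrite cT; lia.
split; last by rewrite rL cT.
split=> //; move: rL; rewrite /rho lL cT; lia.
Qed.

Lemma le_generic_top (N : {set {set 'I_n}}) : P N -> N \subset generic set0.
Proof.
case=> ncN _; apply/subsetP=> B BN; have [x [y [-> xy _ _ _]]] := nc_pairP ncN BN.
by rewrite in_rank2_matroid xy !inE; apply/forallP=> I; rewrite inE.
Qed.

Lemma many_classes_up (N N' : {set {set 'I_n}}) :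
  P N -> noncrossing2 N' -> N \subset N' -> P N'.
Proof.
move=> [ncN le_reps] ncN' sN; split=> //.
by apply: leq_trans le_reps (card_reps_sub ncN ncN' sN).
Qed.

Lemma rho_proper (N N' : {set {set 'I_n}}) : P N -> P N' -> N \proper N' -> (rho N < rho N')%N.
Proof.
move=> [ncN _] [ncN' _]; rewrite properEneq => /andP[neq sN]; rewrite ltnNge.
by apply: contra neq => le_rho; apply/eqP/rho_inj.
Qed.

Lemma minimal_rho (N : {set {set 'I_n}}) : minimal P N ->
  exists2 L : {set 'I_n}, #|L| = k & N = generic L.
Proof.
case=> PN minN; have [L cL sL] := generic_below PN; exists L => //.
by symmetry; apply: minN => //; have [] := generic_small cL.
Qed.

Lemma generic_minimal (L : {set 'I_n}) : #|L| = k -> minimal P (generic L).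
Proof.
move=> cL; have [PL rL] := generic_small cL; split=> // N PN sN.
by apply: rho_inj => //; [case: PN|case: PL|rewrite rL rho_ge].
Qed.

(** The element supplied by [interpolate] is in the poset, so it must be [N] itself. *)
Lemma covered_rho (N N' : {set {set 'I_n}}) : covered_by P N N' -> rho N' = (rho N).+1.
Proof.
case=> PN PN' pN cov; apply/eqP; rewrite eqn_leq rho_proper // andbT.
have [N'' [nc'' s'' p'' le_rho]] := interpolate PN.1 PN'.1 pN.
case: (eqVneq N'' N) le_rho => [-> //|neq _].
case: (cov N''); first exact: many_classes_up PN nc'' s''.
by rewrite properEneq eq_sym neq.
Qed.

Lemma maximal_chain_mem (C : {set {set {set 'I_n}}}) (N : {set {set 'I_n}}) :
  maximal_chain P C -> P N -> (forall K, K \in C -> N \subset K \/ K \subset N) -> N \in C.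
Proof.
case=> -[PC compC] maxC PN compN; rewrite -(maxC (N |: C)) ?setU11 ?subsetUr //.
split=> [K|K K']; rewrite !in_setU1; first by case/predU1P=> [->|/PC].
case/predU1P=> [->|KC] /predU1P[->|KC'].
- by left.
- exact: compN.
- by case: (compN K KC); [right|left].
exact: compC.
Qed.

(** Let [y] be lowest in [C] with [v <= rho y]. If [v < rho y], interpolating between [y] and what
    lies below it gives an element comparable with all of [C], hence in [C], that contradicts the
    choice of [y]. *)
Lemma maximal_chain_rho (C : {set {set {set 'I_n}}}) (v : nat) :
  maximal_chain P C -> (2 * (n - k) <= v <= 2 * n)%N ->
  exists2 N, N \in C & rho N = v.
Proof.
move=> maxC /andP[v_ge v_le]; have [[PC compC] _] := maxC.
have [Ptop rtop] := generic_top.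
have topC : generic set0 \in C.
  by apply: (maximal_chain_mem maxC) => // K /PC PK; right; apply: le_generic_top.
have le_rho K K' : K \in C -> K' \in C -> (rho K <= rho K')%N -> K \subset K'.
  move=> KC KC' leK; case: (compC K K' KC KC') => // sK.
  by rewrite (rho_inj (PC _ KC').1 (PC _ KC).1 sK leK).
have [] := @arg_minnP _ (generic set0) (fun N => (N \in C) && (v <= rho N)%N) (@rho n).
  by rewrite topC rtop.
move=> y /andP[yC v_y] ymin; exists y => //; apply/eqP; rewrite eqn_leq v_y andbT.
rewrite leqNgt; apply/negP => lt_vy.
(* When [C] has nothing of [rho] below [v], a minimal element of the poset below [y] serves as
   [x]. *)
have [x [Px rx sxy xC]] : exists x, [/\ P x, (rho x <= v)%N, x \subset y &
    forall K, K \in C -> (rho K < v)%N -> K \subset x].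
  have [/exists_inP[z zC zv]|none] := boolP [exists z in C, (rho z < v)%N].
    have [] := @arg_maxnP _ z (fun N => (N \in C) && (rho N < v)%N) (@rho n).
      by rewrite zC zv.
    move=> x /andP[xC xv] xmax; exists x; split; first exact: PC.
    - exact: ltnW.
    - by apply: le_rho => //; apply: leq_trans v_y; apply: ltnW.
    by move=> K KC Kv; apply: le_rho => //; apply: xmax; rewrite KC.
  have [L cL sL] := generic_below (PC y yC); have [PL rL] := generic_small cL.
  exists (generic L); split=> //; first by rewrite rL.
  by move=> K KC Kv; case/exists_inP: none; exists K.
have pxy : x \proper y.
  rewrite properEneq sxy andbT; apply: contraTneq lt_vy => <-.
  by rewrite -leqNgt.
have [N [ncN sxN pNy le_y]] := interpolate Px.1 (PC y yC).1 pxy.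
have PN : P N by apply: many_classes_up Px ncN sxN.
have NC : N \in C.
  apply: (maximal_chain_mem maxC) => // K KC.
  case: (ltnP (rho K) v) => [Kv|vK].
    by right; apply: subset_trans sxN; apply: xC.
  left; apply: subset_trans (proper_sub pNy) _; apply: le_rho => //.
  by apply: ymin; rewrite KC.
have lt_N := rho_proper PN (PC y yC) pNy.
have : (rho y <= rho N)%N by apply: ymin; rewrite NC -ltnS (leq_trans lt_vy).
by rewrite leqNgt lt_N.
Qed.

Lemma maximal_chain_card : graded_of_height P (2 * k)%N.
Proof.
move=> C maxC; have [[PC compC] _] := maxC.
(* On the poset [rho] ranges from [2 * (n - k)] to [2 * n], so the shifted values fit in
   ['I_(2 * k).+1] and the default of [inord] is never reached on [C]. *)
pose f (N : {set {set 'I_n}}) : 'I_(2 * k).+1 := inord (rho N - 2 * (n - k)).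
have rho_le N : N \in C -> (rho N <= 2 * n)%N.
  move=> NC; have [Pt <-] := generic_top.
  exact: rho_sub (PC N NC).1 Pt.1 (le_generic_top (PC N NC)).
have fE N : N \in C -> f N = (rho N - 2 * (n - k))%N :> nat.
  by move=> NC; rewrite inordK //; have := rho_le N NC; move: hnk; clear; lia.
rewrite -(card_in_imset (f := f) (D := mem C)); last first.
  move=> K K' KC KC' /(congr1 val) /=; rewrite !fE // => E.
  have E' : rho K = rho K'.
    by have := rho_ge (PC K KC); have := rho_ge (PC K' KC'); move: E; clear; lia.
  case: (compC K K' KC KC') => sK; first by apply: (rho_inj (PC K KC).1 (PC K' KC').1); rewrite ?E'.
  by symmetry; apply: (rho_inj (PC K' KC').1 (PC K KC).1); rewrite ?E'.
rewrite -[RHS]card_ord -cardsT; apply: eq_card => i; rewrite [RHS]inE.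
have [|N NC rN] := @maximal_chain_rho C (i + 2 * (n - k)) maxC.
  by rewrite leq_addl; move: (ltn_ord i) hnk; clear; lia.
apply/imsetP; exists N => //; apply: ord_inj.
by rewrite fE // rN addnK.
Qed.

Lemma d_rank_rho (N : {set {set 'I_n}}) : P N ->
  d_rank k N = (rho N)%:Z - (2 * (n - k))%:Z.
Proof. by case=> ncN _; rewrite d_rankE // /rho; move: hnk; clear; lia. Qed.

Lemma d_rank_function : rank_function P (d_rank k).
Proof.
split=> [N minN|N N' cov].
  have [PN _] := minN; have [L cL NE] := minimal_rho minN.
  by rewrite d_rank_rho // NE (generic_small cL).2 subrr.
have [PN PN' _ _] := cov; rewrite !d_rank_rho // (covered_rho cov).
by clear; lia.
Qed.

Lemma c_corank_function : corank_function P (c_corank k).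
Proof.
split=> [N [PN maxN]|N N' cov]; rewrite /c_corank; last first.
  by have [_ /(_ _ _ cov)->] := d_rank_function; clear; lia.
have [Ptop rtop] := generic_top; rewrite -(maxN _ Ptop (le_generic_top PN)).
by rewrite d_rank_rho // rtop; move: hnk; clear; lia.
Qed.

(** [L] is recovered from its minimal element as the set of loops. *)
Lemma card_minimal :
  #|[set N : {set {set 'I_n}} | `[< minimal P N >]]| = 'C(n, k).
Proof.
have loopsE (L : {set 'I_n}) : #|L| = k -> loops (generic L) = L.
  move=> cL; have [|_ -> //] := @noncrossing_generic n L.
  by rewrite card_setC_small //; lia.
have -> : [set N : {set {set 'I_n}} | `[< minimal P N >]] =
    (fun L => generic L) @: [set L : {set 'I_n} | #|L| == k].
  apply/setP=> N; rewrite inE; apply/asboolP/imsetP => [/minimal_rho[L cL ->]|[L + ->]].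
    by exists L; rewrite ?inE ?cL.
  by rewrite inE => /eqP; apply: generic_minimal.
rewrite card_in_imset ?card_draws ?card_ord // => L L'.
by rewrite !inE => /eqP cL /eqP cL' E; rewrite -(loopsE L cL) E loopsE.
Qed.

End RankedPoset.

Theorem theorem3p9 (R : realType) (n k : nat) (hk : (1 <= k)%N)
    (hnk : (k + 2 <= n)%N) :
  [/\ [/\ upper_order_ideal (@Pnk R n k) (@Qnk R n 2),
          #|[set N : {set {set 'I_n}} | `[< minimal (@Pnk R n k) N >]]| = 'C(n, k) &
          forall N : {set {set 'I_n}},
            minimal (@Pnk R n k) N <->
            exists L : {set 'I_n}, #|L| = k /\ N = rank2_matroid L set0],
      forall N : {set {set 'I_n}}, @Pnk R n k N <-> @Qnk R n 2 N /\ 0 <= e_stat k N &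
      [/\ graded_of_height (@Pnk R n k) (2 * k)%N,
          rank_function (@Pnk R n k) (d_rank k) &
          corank_function (@Pnk R n k) (c_corank k)]].
Proof.
rewrite (PnkE R hnk); split; [split|move=> N|split].
- split=> [N [ncN _]|N N' PN QN' sN]; first exact: noncrossing_Qn2.
  exact: many_classes_up PN (Qn2_noncrossing QN') sN.
- exact: card_minimal.
- move=> N; split=> [/(minimal_rho hnk)[L cL ->]|[L [cL ->]]]; first by exists L.
  exact: generic_minimal.
- split=> [[ncN le_reps]|[QN e_ge0]].
    split; first exact: noncrossing_Qn2.
    by rewrite e_statE //; move: le_reps hnk; clear; lia.
  have ncN := Qn2_noncrossing QN; split=> //.
  by move: e_ge0; rewrite e_statE //; move: hnk; clear; lia.
- exact: maximal_chain_card.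
- exact: d_rank_function.
- exact: c_corank_function.
Qed.
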